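(* Any finest stability data on $\mathrm{coh}\,\mathbb{P}^1$ has the form $$(\mathbb{Z}\cup\mathbb{P}^1,\{\Pi_\varphi\}_{\varphi\in\mathbb{Z}\cup\mathbb{P}^1}),$$ where $\mathbb{Z}\cup\mathbb{P}^1$ is a linearly ordered set obtained from the natural order on $\mathbb{Z}$, an arbitrary choice of linear order on the points of $\mathbb{P}^1$, and the relations $n<\boldsymbol{x}$ for all $n\in\mathbb{Z}$, $\boldsymbol{x}\in\mathbb{P}^1$; and where $\Pi_n=\langle\mathcal{O}(n)\rangle$ for any $n\in\mathbb{Z}$, and $\Pi_{\boldsymbol{x}}=\langle S_{\boldsymbol{x}}\rangle$ for any $\boldsymbol{x}\in\mathbb{P}^1$.
   Context: $\mathbf{k}$ is an algebraically closed field, $\mathbb{P}^1=\mathbb{P}^1_{\mathbf{k}}$ is the projective line (also denoting its set of closed points), $\mathrm{coh}\,\mathbb{P}^1$ is its category of coherent sheaves, $\mathcal{O}(n)$ is the line bundle of degree $n$, and $S_{\boldsymbol{x}}$ is the simple torsion sheaf at the point $\boldsymbol{x}$. All subcategories are full and closed under isomorphisms. $\langle\mathcal{S}\rangle$ denotes the subcategory generated by $\mathcal{S}$, closed under extensions and direct summands. A stability data on an abelian category $\mathcal{A}$ is a pair $(\Phi,\{\Pi_\varphi\}_{\varphi\in\Phi})$ where $\Phi$ is a linearly ordered set and each $\Pi_\varphi\subset\mathcal{A}$ is an extension-closed subcategory, such that: (1) $\mathrm{Hom}(\Pi_{\varphi'},\Pi_{\varphi''})=0$ for all $\varphi'>\varphi''$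 in $\Phi$; (2) every non-zero $X\in\mathcal{A}$ has a finite filtration $0=X_0\subset X_1\subset\cdots\subset X_n=X$ with non-zero factors $X_i/X_{i-1}\in\Pi_{\varphi_i}$ and strictly decreasing $\varphi_1>\cdots>\varphi_n$. Stability data are considered up to equivalence: $(\Phi,\{\Pi_\varphi\})$ and $(\Psi,\{P_\psi\})$ are equivalent if there is an order-preserving bijection $r:\Phi\to\Psi$ with $P_{r(\varphi)}=\Pi_\varphi$ for all $\varphi\in\Phi$. $(\Psi,\{P_\psi\})$ is finer than $(\Phi,\{\Pi_\varphi\})$ if there is a surjective map $r:\Psi\to\Phi$ such that $\psi'>\psi''$ implies $r(\psi')\geq r(\psi'')$, and $\Pi_\varphi=\langle P_\psi\mid\psi\in r^{-1}(\varphi)\rangle$ for every $\varphi\in\Phi$. This defines a partial ordering on stability data; a stability data is finest if it is extremal for this ordering in the sense that no other stability data is finer than it. *)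

(* Defs.v *)
From HB Require Import structures.
From mathcomp Require Import all_boot all_order all_algebra.
From mathcomp Require Import boolp.
Set Implicit Arguments.
Unset Strict Implicit.
Unset Printing Implicit Defensive.
Import GRing.Theory.
Local Open Scope ring_scope.

(* The projective line over k is covered by U0 = Spec k[x] and U1 = Spec k[y],
   glued along U01 = Spec k[x, x^-1] by y = x^-1.  As these opens are affine, a
   coherent sheaf amounts to its modules of sections over U0, U1 and U01 with
   the restriction maps: the modules over U0 and U1 are finitely generated and
   both restrictions to U01 are localizations. *)

Section Laurent.
Variable k : fieldType.

Definition laurent_pred : {pred {fraction {poly k}}} :=
  fun f => `[< exists p n, f * tofrac 'X^n = tofrac p >].

Fact laurent_subring : subring_closed laurent_pred.
Proof.
split.
- by apply/asboolP; exists 1, 0%N; rewrite expr0 mulr1.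
- move=> f g /asboolP[p [n fp]] /asboolP[q [m gq]]; apply/asboolP.
  exists (p * 'X^m - q * 'X^n), (n + m)%N.
  rewrite exprD !rmorphB !rmorphM /= -fp -gq mulrBl; congr (_ - _).
    by rewrite mulrA.
  by rewrite -mulrA [X in _ * X]mulrC.
move=> f g /asboolP[p [n fp]] /asboolP[q [m gq]]; apply/asboolP.
exists (p * q), (n + m)%N.
by rewrite exprD !rmorphM /= -fp -gq mulrACA.
Qed.
HB.instance Definition _ :=
  GRing.isSubringClosed.Build {fraction {poly k}} laurent_pred laurent_subring.

Record laurent : Type := Laurent {
  laurent_val :> {fraction {poly k}};
  _ : laurent_val \in laurent_pred }.
HB.instance Definition _ := [isSub for laurent_val].
HB.instance Definition _ := [Choice of laurent by <:].
HB.instance Definition _ := [SubChoice_isSubComNzRing of laurent by <:].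

Fact laurent_of_poly_subproof (p : {poly k}) : tofrac p \in laurent_pred.
Proof. by apply/asboolP; exists p, 0%N; rewrite expr0 mulr1. Qed.
Definition chart0 (p : {poly k}) : laurent :=
  Laurent (laurent_of_poly_subproof p).

Fact chart0_is_zmod_morphism : zmod_morphism chart0.
Proof. by move=> p q; apply: val_inj; rewrite /= rmorphB. Qed.
Fact chart0_is_monoid_morphism : monoid_morphism chart0.
Proof.
by split=> [|p q]; apply: val_inj; rewrite /= ?rmorph1 ?rmorphM.
Qed.
HB.instance Definition _ :=
  GRing.isZmodMorphism.Build {poly k} laurent chart0 chart0_is_zmod_morphism.
HB.instance Definition _ :=
  GRing.isMonoidMorphism.Build {poly k} laurent chart0
    chart0_is_monoid_morphism.

Fact laurent_xV_subproof : (tofrac ('X : {poly k}))^-1 \in laurent_pred.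
Proof.
apply/asboolP; exists 1, 1%N.
by rewrite expr1 rmorph1 mulVf // tofrac_eq0 polyX_eq0.
Qed.
Definition laurent_xV : laurent := Laurent laurent_xV_subproof.

(* the morphism k[y] -> k[x, x^-1] sending y to x^-1 *)
Definition chart1 : {poly k} -> laurent :=
  horner_morph (fun c => mulrC laurent_xV ((chart0 \o polyC) c)).
HB.instance Definition _ := GRing.RMorphism.on chart1.

Lemma laurent_xVx : laurent_xV * chart0 'X = 1.
Proof. by apply: val_inj; rewrite /= mulVf // tofrac_eq0 polyX_eq0. Qed.

Definition laurent_xexp (n : int) : laurent :=
  match n with
  | Posz m => chart0 'X ^+ m
  | Negz m => laurent_xV ^+ m.+1
  end.

Fact laurent_repr (f : laurent) :
  exists u : {poly k} * nat, laurent_val f * tofrac 'X^(u.2) == tofrac u.1.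
Proof. by case: f => f /= /asboolP[p [n fp]]; exists (p, n); apply/eqP. Qed.

(* Evaluation of p / x^n at a nonzero point a; laurent_evalE below shows that
   the choice of p and n is immaterial. *)
Definition laurent_eval (a : k) of a != 0 := fun f : laurent =>
  let u := xchoose (laurent_repr f) in u.1.[a] / a ^+ u.2.

Lemma laurent_evalE (a : k) (a0 : a != 0) f p n :
  laurent_val f * tofrac 'X^n = tofrac p -> laurent_eval a0 f = p.[a] / a ^+ n.
Proof.
move=> fp; rewrite /laurent_eval.
case: (xchoose _) (xchooseP (laurent_repr f)) => q m /= /eqP fq.
have: tofrac (q * 'X^n) = tofrac (p * 'X^m).
  by rewrite !rmorphM /= -fp -fq mulrAC.
move/eqP; rewrite tofrac_eq => /eqP/(congr1 (fun r => r.[a])).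
rewrite !hornerM !horner_exp !hornerX => e.
by apply/eqP; rewrite eqr_div ?expf_neq0 // e.
Qed.

Section EvalMorphism.
Variables (a : k) (a0 : a != 0).

Fact laurent_eval_is_zmod_morphism : zmod_morphism (laurent_eval a0).
Proof.
move=> f g.
have [[p n] /= /eqP fp] := laurent_repr f.
have [[q m] /= /eqP gq] := laurent_repr g.
rewrite (laurent_evalE a0 fp) (laurent_evalE a0 gq).
rewrite (@laurent_evalE _ a0 _ (p * 'X^m - q * 'X^n) (n + m)).
  rewrite hornerD hornerN !hornerM !horner_exp !hornerX exprD mulrBl.
  by congr (_ - _); [rewrite -mulf_div | rewrite [X in _ / X]mulrC -mulf_div];
    rewrite divff ?mulr1 ?expf_neq0.
rewrite exprD !rmorphB !rmorphM /= -fp -gq mulrBl; congr (_ - _).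
  by rewrite mulrA.
by rewrite -mulrA [X in _ * X]mulrC.
Qed.

Fact laurent_eval_is_monoid_morphism : monoid_morphism (laurent_eval a0).
Proof.
split=> [|f g].
  rewrite (@laurent_evalE _ a0 _ 1 0) ?expr0 ?hornerC ?divr1 //.
  by rewrite /= rmorph1 mulr1.
have [[p n] /= /eqP fp] := laurent_repr f.
have [[q m] /= /eqP gq] := laurent_repr g.
rewrite (laurent_evalE a0 fp) (laurent_evalE a0 gq).
rewrite (@laurent_evalE _ a0 _ (p * q) (n + m)).
  by rewrite hornerM exprD mulf_div.
by rewrite exprD !rmorphM /= -fp -gq mulrACA.
Qed.

HB.instance Definition _ := GRing.isZmodMorphism.Build laurent k
  (laurent_eval a0) laurent_eval_is_zmod_morphism.
HB.instance Definition _ := GRing.isMonoidMorphism.Build laurent k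
  (laurent_eval a0) laurent_eval_is_monoid_morphism.
End EvalMorphism.

Lemma laurent_eval_chart0 (a : k) (a0 : a != 0) p :
  laurent_eval a0 (chart0 p) = p.[a].
Proof. by rewrite (@laurent_evalE _ _ _ p 0) ?expr0 ?divr1 //= rmorph1 mulr1. Qed.

Lemma chart1C c : chart1 c%:P = chart0 c%:P.
Proof. exact: horner_morphC. Qed.

Lemma chart1X : chart1 'X = laurent_xV.
Proof. exact: horner_morphX. Qed.

Lemma laurent_eval_chart1 (a : k) (a0 : a != 0) p :
  laurent_eval a0 (chart1 p) = p.[a^-1].
Proof.
have eX : laurent_eval a0 laurent_xV = a^-1.
  apply: (mulIf a0); rewrite mulVf //.
  by rewrite -[X in _ * X](hornerX a) -(laurent_eval_chart0 a0) -rmorphM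
             laurent_xVx rmorph1.
elim/poly_ind: p => [|p c IH]; first by rewrite !rmorph0 horner0.
rewrite !rmorphD !rmorphM /= IH chart1C chart1X eX.
by rewrite laurent_eval_chart0 !hornerE.
Qed.

End Laurent.
Arguments chart1 {k} p : rename.

Definition finitely_generated (R : nzRingType) (M : lmodType R) : Prop :=
  exists n (g : 'I_n -> M), forall m, exists c : 'I_n -> R,
    m = \sum_(i < n) c i *: g i.

(* f exhibits the S-module N as the localization of the R-module M at x, where
   S is the localization of R at x through e. *)
Definition is_localization (R S : nzRingType) (e : {rmorphism R -> S}) (x : R)
    (M : lmodType R) (N : lmodType S) (f : {linear M -> N | e \; *:%R}) : Prop :=
  (forall m, f m = 0 -> exists n, x ^+ n *: m = 0) /\
  (forall s, exists n m, e (x ^+ n) *: s = f m).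

Definition restr_scalars (R S : nzRingType) (e : {rmorphism R -> S})
  (M : lmodType S) : Type := M.

Section RestrScalars.
Variables (R S : nzRingType) (e : {rmorphism R -> S}) (M : lmodType S).
HB.instance Definition _ := GRing.Zmodule.on (restr_scalars e M).
Let scale (r : R) (m : restr_scalars e M) : restr_scalars e M :=
  e r *: (m : M).
Fact restr_scalarsA a b m : scale a (scale b m) = scale (a * b) m.
Proof. by rewrite /scale scalerA rmorphM. Qed.
Fact restr_scalars1 : left_id 1 scale.
Proof. by move=> m; rewrite /scale rmorph1 scale1r. Qed.
Fact restr_scalarsDr : right_distributive scale +%R.
Proof. by move=> a m m'; rewrite /scale scalerDr. Qed.
Fact restr_scalarsDl m : {morph scale^~ m : a b / a + b}.
Proof. by move=> a b; rewrite /scale rmorphD scalerDl. Qed.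
HB.instance Definition _ := GRing.Zmodule_isLmodule.Build R
  (restr_scalars e M) restr_scalarsA restr_scalars1 restr_scalarsDr
  restr_scalarsDl.
End RestrScalars.

Record coh (k : fieldType) := Coh {
  sec0 : lmodType {poly k};
  sec1 : lmodType {poly k};
  sec01 : lmodType (laurent k);
  res0 : {linear sec0 -> sec01 | @chart0 k \; *:%R};
  res1 : {linear sec1 -> sec01 | @chart1 k \; *:%R};
  coh_fg0 : finitely_generated sec0;
  coh_fg1 : finitely_generated sec1;
  coh_loc0 : is_localization 'X res0;
  coh_loc1 : is_localization 'X res1 }.

Record coh_hom (k : fieldType) (F G : coh k) := CohHom {
  hom0 : {linear sec0 F -> sec0 G};
  hom1 : {linear sec1 F -> sec1 G};
  hom01 : {linear sec01 F -> sec01 G};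
  hom_res0 : forall m, hom01 (res0 F m) = res0 G (hom0 m);
  hom_res1 : forall m, hom01 (res1 F m) = res1 G (hom1 m) }.

Section Category.
Variable k : fieldType.
Implicit Types F G H A B C : coh k.

Definition hom_is_zero F G (f : coh_hom F G) : Prop :=
  [/\ forall m, hom0 f m = 0, forall m, hom1 f m = 0
    & forall m, hom01 f m = 0].

Definition cancel_hom F G (f : coh_hom F G) (g : coh_hom G F) : Prop :=
  [/\ cancel (hom0 f) (hom0 g), cancel (hom1 f) (hom1 g)
    & cancel (hom01 f) (hom01 g)].

Definition coh_iso F G : Prop :=
  exists (f : coh_hom F G) (g : coh_hom G F), cancel_hom f g /\ cancel_hom g f.

Definition is_zero F : Prop :=
  [/\ forall m : sec0 F, m = 0, forall m : sec1 F, m = 0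
    & forall m : sec01 F, m = 0].

Definition short_exact_map (U V W : zmodType) (f : U -> V) (g : V -> W) : Prop :=
  [/\ injective f, forall w, exists v, g v = w
    & forall v, g v = 0 <-> exists u, f u = v].

(* 0 -> A -> B -> C -> 0; sequences of coherent sheaves are exact when they are
   so on the sections over affine opens *)
Definition short_exact A B C (i : coh_hom A B) (q : coh_hom B C) : Prop :=
  [/\ short_exact_map (hom0 i) (hom0 q), short_exact_map (hom1 i) (hom1 q)
    & short_exact_map (hom01 i) (hom01 q)].

(* B = A (+) C for some C, i.e. some 0 -> A -> B -> C -> 0 is split *)
Definition direct_summand A B : Prop :=
  exists C (i : coh_hom A B) (q : coh_hom B C) (p : coh_hom B A),
    short_exact i q /\ cancel_hom i p.

Definition subcategory := coh k -> Prop.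
Implicit Types P S : subcategory.

Definition iso_closed P : Prop := forall F G, coh_iso F G -> P F -> P G.

Definition extension_closed P : Prop :=
  forall A B C (i : coh_hom A B) (q : coh_hom B C),
    short_exact i q -> P A -> P C -> P B.

Inductive generated S : subcategory :=
| generated_in F of S F : generated S F
| generated_iso F G of coh_iso F G & generated S F : generated S G
| generated_ext A B C (i : coh_hom A B) (q : coh_hom B C) of
    short_exact i q & generated S A & generated S C : generated S B
| generated_summand A B of direct_summand A B & generated S B : generated S A.

Definition linear_order (T : Type) (le : rel T) : Prop :=
  [/\ reflexive le, antisymmetric le, transitive le & total le].

(* a set with a relation and a subcategory for each of its elements *)
Record slicing := Slicing {
  phase : Type;
  phase_le : rel phase;
  slice : phase -> subcategory }.
Implicit Types D E : slicing.

(* the strict order of a linear order *)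
Definition phase_lt D (a b : phase D) : bool := ~~ phase_le b a.

(* X 0 < X 1 < ... < X n = F with X 0 = 0 and factors Q i = X (i + 1) / X i *)
Definition has_HN_filtration D F : Prop :=
  exists (n : nat) (X Q : nat -> coh k) (phi : nat -> phase D),
    [/\ is_zero (X 0%N), coh_iso (X n) F,
        forall j, (j < n)%N ->
          (exists (i : coh_hom (X j) (X j.+1)) (q : coh_hom (X j.+1) (Q j)),
             short_exact i q) /\
          ~ is_zero (Q j) /\ slice (phi j) (Q j)
      & forall i j, (i < j < n)%N -> phase_lt (phi j) (phi i)].

(* Subcategories contain 0, and the slices are nonzero: otherwise zero slices
   could always be added and refinement would not be a partial order. *)
Record is_stability_data D : Prop := IsStabilityData {
  stab_order : linear_order (@phase_le D);
  stab_zero : forall (a : phase D) F, is_zero F -> slice a F;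
  stab_nonzero : forall a : phase D, exists2 F, slice a F & ~ is_zero F;
  stab_iso : forall a : phase D, iso_closed (slice a);
  stab_ext : forall a : phase D, extension_closed (slice a);
  stab_hom : forall (a b : phase D) F G (f : coh_hom F G),
    phase_lt b a -> slice a F -> slice b G -> hom_is_zero f;
  stab_HN : forall F, ~ is_zero F -> has_HN_filtration D F }.

Definition equivalent D E : Prop :=
  exists r : phase D -> phase E,
    [/\ bijective r, {mono r : a b / phase_le a b}
      & forall a F, slice (r a) F <-> slice a F].

(* E is finer than D *)
Definition finer E D : Prop :=
  exists r : phase E -> phase D,
    [/\ forall a, exists b, r b = a,
        forall b b', phase_lt b' b -> phase_le (r b') (r b)
      & forall a F, slice a F <->
          generated (fun G => exists2 b, r b = a & slice b G) F].

Definition finest D : Prop :=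
  is_stability_data D /\
  forall E, is_stability_data E -> finer E D -> equivalent E D.

End Category.

Section LineBundle.
Variable (k : fieldType) (n : int).
Local Notation L := ((laurent k)^o).

Definition line_res0 (p : {poly k}^o) : L := chart0 (p : {poly k}).
(* With x = x1 / x0, x0^n and x1^n trivialize O(n) on U0 and U1, and
   x1^n = x^n x0^n. *)
Definition line_res1 (p : {poly k}^o) : L :=
  chart1 (p : {poly k}) * laurent_xexp k n.

Fact line_res0_linear : linear_for (@chart0 k \; *:%R) line_res0.
Proof. by move=> a u v; rewrite /line_res0 /= rmorphD rmorphM. Qed.
Fact line_res1_linear : linear_for (@chart1 k \; *:%R) line_res1.
Proof.
by move=> a u v; rewrite /line_res1 /= rmorphD rmorphM mulrDl -mulrA.
Qed.
HB.instance Definition _ := GRing.isLinear.Build {poly k} {poly k}^o L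
  (@chart0 k \; *:%R) line_res0 line_res0_linear.
HB.instance Definition _ := GRing.isLinear.Build {poly k} {poly k}^o L
  (@chart1 k \; *:%R) line_res1 line_res1_linear.

Fact line_fg : finitely_generated ({poly k}^o).
Proof.
exists 1%N, (fun=> 1) => m; exists (fun=> m).
by rewrite big_ord1 /GRing.scale /= mulr1.
Qed.

Fact laurent_xexpN : laurent_xexp k n * laurent_xexp k (- n) = 1.
Proof.
have xK m : chart0 'X ^+ m * laurent_xV k ^+ m = 1.
  by rewrite -exprMn_comm ?[_ * laurent_xV k]mulrC ?laurent_xVx ?expr1n //;
    apply: mulrC.
case: n => [[|m]|m]; first by rewrite mulr1.
  by rewrite /= xK.
by rewrite NegzE opprK -NegzE /= mulrC xK.
Qed.

Fact chart0_inj : injective (@chart0 k).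
Proof. by move=> p q /(congr1 val) /eqP; rewrite /= tofrac_eq => /eqP. Qed.

Fact chart1_eq0 (p : {poly k}) : chart1 p = 0 -> p = 0.
Proof.
have xK m : laurent_xV k ^+ m * chart0 'X ^+ m = 1.
  rewrite -exprMn_comm ?laurent_xVx ?expr1n //; exact: mulrC.
set m := size p => p0.
suff e : chart1 p * chart0 'X ^+ m = chart0 (\sum_(i < m) p`_i *: 'X^(m - i)).
  move: e; rewrite p0 mul0r -(rmorph0 (@chart0 k)) => /chart0_inj e.
  apply/polyP => i; rewrite coef0; case: (ltnP i m) => [im|im]; last first.
    exact: nth_default.
  move: (congr1 (fun q : {poly k} => q`_(m - i)) e).
  rewrite coef0 coef_sum (bigD1 (Ordinal im)) //= coefZ coefXn eqxx mulr1.
  rewrite big1 ?addr0 // => j ji; rewrite coefZ coefXn.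
  case: eqP => [h|]; last by rewrite mulr0.
  case/eqP: ji; apply: val_inj => /=.
  by rewrite -(subKn (ltnW im)) h subKn // ltnW.
rewrite -{1}(coefK p) poly_def !rmorph_sum mulr_suml; apply: eq_bigr => i _.
rewrite -!mul_polyC !rmorphM !rmorphXn /= chart1C chart1X -mulrA; congr (_ * _).
have im : (i <= m)%N by apply: ltnW.
by rewrite -{1}(subnKC im) exprD mulrA xK mul1r.
Qed.

Fact line_loc0 : is_localization 'X (line_res0 : {linear _ -> L | _}).
Proof.
split=> [m|s].
  rewrite /= /line_res0 -(rmorph0 (@chart0 k)) => /chart0_inj ->.
  by exists 0%N; rewrite scaler0.
have [[p m] /= /eqP e] := laurent_repr s; exists m, p.
by apply: val_inj => /=; rewrite mulrC e.
Qed.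

Fact laurent_chart1 (s : laurent k) :
  exists m q, laurent_xV k ^+ m * s = chart1 q.
Proof.
have H (p : {poly k}) : exists m q, laurent_xV k ^+ m * chart0 p = chart1 q.
  elim/poly_ind: p => [|p c [m [q e]]].
    by exists 0%N, 0; rewrite !rmorph0 mulr0.
  exists m.+1, (q + c%:P * 'X^(m.+1)).
  rewrite !rmorphD !rmorphM rmorphXn /= chart1C chart1X -e mulrDr.
  rewrite [X in _ + X]mulrC; congr (_ + _).
  by rewrite exprSr [chart0 p * _]mulrC -!mulrA [laurent_xV k * (_ * _)]mulrA
             laurent_xVx mul1r.
have [[p m] /= /eqP e] := laurent_repr s.
have sE : s * chart0 'X ^+ m = chart0 p.
  by rewrite -rmorphXn; apply: val_inj.
have [N [q eq]] := H p; exists N, (q * 'X^m).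
rewrite rmorphM rmorphXn /= chart1X -eq -sE.
have xK : chart0 'X ^+ m * laurent_xV k ^+ m = 1.
  rewrite -exprMn_comm ?[_ * laurent_xV k]mulrC ?laurent_xVx ?expr1n //.
  exact: mulrC.
by rewrite -!mulrA xK mulr1.
Qed.

Fact line_loc1 : is_localization 'X (line_res1 : {linear _ -> L | _}).
Proof.
split=> [m|s].
  rewrite /= /line_res1 => /(congr1 (fun u => u * laurent_xexp k (- n))).
  rewrite -mulrA laurent_xexpN mulr1 mul0r => /chart1_eq0 ->.
  by exists 0%N; rewrite scaler0.
have [m [q e]] := laurent_chart1 (s * laurent_xexp k (- n)).
exists m, q; rewrite /= /line_res1 -e rmorphXn /= chart1X -!mulrA.
by rewrite [laurent_xexp k (- n) * _]mulrC laurent_xexpN mulr1.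
Qed.

Definition line_bundle : coh k := Coh line_fg line_fg line_loc0 line_loc1.
End LineBundle.

Section Skyscraper.
Variable k : fieldType.

(* the R-module k on which R acts through e *)
Local Notation point e := (restr_scalars e k^o).

Fact point_fg (a : k) : finitely_generated (point (horner_eval a)).
Proof.
exists 1%N, (fun=> 1) => m; exists (fun=> (m : k)%:P).
by rewrite big_ord1 /GRing.scale /= /GRing.scale /= /horner_eval hornerC mulr1.
Qed.

Fact zero_fg : finitely_generated ('rV[{poly k}]_0).
Proof.
by exists 0%N, (fun=> 0) => m; exists (fun=> 0); rewrite big_ord0 thinmx0.
Qed.

Lemma point_scale (R : nzRingType) (e : {rmorphism R -> k}) (r : R)
  (m : point e) : r *: m = e r * (m : k) :> k.
Proof. by []. Qed.

Section AtOrigin.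
(* a point outside U01, seen in the chart where its coordinate is 0; c is the
   map from the coordinate ring of that chart to that of U01 *)
Variable c : {rmorphism {poly k} -> laurent k}.

Fact origin_loc : is_localization 'X
  (\0 : {linear point (horner_eval (0 : k)) -> 'rV[laurent k]_0 | c \; *:%R}).
Proof.
split=> [m _|s]; first by exists 1%N; rewrite point_scale /= /horner_eval
  hornerX mul0r.
by exists 0%N, 0; apply: thinmx0.
Qed.

Fact zero_loc : is_localization 'X
  (\0 : {linear 'rV[{poly k}]_0 -> 'rV[laurent k]_0 | c \; *:%R}).
Proof.
split=> [m _|s]; first by exists 0%N; apply: thinmx0.
by exists 0%N, 0; apply: thinmx0.
Qed.
End AtOrigin.

Definition skyscraper_zero : coh k :=
  Coh (point_fg 0) zero_fg (origin_loc (@chart0 k)) (zero_loc (@chart1 k)).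

Definition skyscraper_infty : coh k :=
  Coh zero_fg (point_fg 0) (zero_loc (@chart0 k)) (origin_loc (@chart1 k)).

Section Generic.
Variables (a : k) (a0 : a != 0).

Definition point_res0 (m : point (horner_eval a)) : point (laurent_eval a0) :=
  (m : k).
Definition point_res1 (m : point (horner_eval a^-1)) : point (laurent_eval a0) :=
  (m : k).

Fact point_res0_linear : linear_for (@chart0 k \; *:%R) point_res0.
Proof.
move=> p u v; rewrite /point_res0 /= [in RHS]/GRing.scale /=.
by rewrite laurent_eval_chart0.
Qed.
Fact point_res1_linear : linear_for (@chart1 k \; *:%R) point_res1.
Proof.
move=> p u v; rewrite /point_res1 /= [in RHS]/GRing.scale /=.
by rewrite laurent_eval_chart1.
Qed.
HB.instance Definition _ := GRing.isLinear.Build {poly k} _ _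
  (@chart0 k \; *:%R) point_res0 point_res0_linear.
HB.instance Definition _ := GRing.isLinear.Build {poly k} _ _
  (@chart1 k \; *:%R) point_res1 point_res1_linear.

Fact point_loc0 : is_localization 'X
  (point_res0 : {linear _ -> _ | @chart0 k \; *:%R}).
Proof.
split=> [m m0|s]; first by exists 0%N; rewrite expr0 scale1r.
by exists 0%N, s; rewrite expr0 rmorph1 scale1r.
Qed.
Fact point_loc1 : is_localization 'X
  (point_res1 : {linear _ -> _ | @chart1 k \; *:%R}).
Proof.
split=> [m m0|s]; first by exists 0%N; rewrite expr0 scale1r.
by exists 0%N, s; rewrite expr0 rmorph1 scale1r.
Qed.

Definition skyscraper_generic : coh k :=
  Coh (point_fg a) (point_fg a^-1) point_loc0 point_loc1.
End Generic.

(* Closed points of P^1: Some a is the point x = a of U0, and None is the point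
   y = 0 of U1. *)
Definition P1 : Type := option k.

(* S_p: its sections over U are k when U contains p, with functions acting by
   their value at p, and 0 otherwise *)
Definition skyscraper (p : P1) : coh k :=
  match p with
  | None => skyscraper_infty
  | Some a =>
      match @idP (a != 0) with
      | ReflectT a0 => skyscraper_generic a0
      | ReflectF _ => skyscraper_zero
      end
  end.

(* the order on Z + P^1 given by the order on Z, an order on P^1, and n < p *)
Definition standard_le (le : rel P1) : rel (int + P1) := fun u v =>
  match u, v with
  | inl m, inl n => (m <= n)%R
  | inl _, inr _ => true
  | inr _, inl _ => false
  | inr p, inr q => le p q
  end.

Definition standard_slice (u : int + P1) : subcategory k :=
  match u with
  | inl n => generated (eq (line_bundle k n))
  | inr p => generated (eq (skyscraper p))
  end.

Definition standard_slicing (le : rel P1) : slicing k :=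
  Slicing (standard_le le) standard_slice.

End Skyscraper.

(* Main.v *)
(* It suffices to refine an arbitrary stability data D to a standard one.

   Every sheaf F has a filtration whose factors O(n) and S_p come in the
   standard order.  If F maps nontrivially to some O(n), take n minimal: then
   F -> O(n) is onto, because a map vanishing at a point p factors through
   O(n - 1), and its kernel does not map to O(n - 1), because H^1(O(-1)) = 0
   lets such a map extend to F; the kernel has smaller rank.  If F maps to no
   O(n), it is torsion and of finite length, so that it maps onto S_p for
   finitely many p only.  Take the smallest of these p: the kernel F' has
   smaller length, and a nonzero map from F' to S_q, q != p, or to O(n) gives
   one from F to S_q or O(n + 1), by multiplication with a section of O(1)
   vanishing at p.

   Each S_p is D-semistable, being simple.  If O(n) were not, its
   Harder-Narasimhan filtration would provide a subsheaf A and a torsion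
   quotient B with Hom(A, B) = 0; but A has some O(c) as a quotient, and O(c)
   maps nontrivially to every nonzero torsion sheaf.  So O(n) and S_p have
   phases in D, and these are nondecreasing for a standard order in which the
   points are sorted by phase.  A nonzero F of phase a in D maps onto the last
   factor of its standard filtration and contains the first one, so that all
   the factors have phase a. *)

From HB Require Import structures.
Require Import Defs.
From mathcomp Require Import all_boot all_order all_algebra.
From mathcomp Require Import boolp zify ring.
From mathcomp Require wochoice.
Set Implicit Arguments.
Unset Strict Implicit.
Unset Printing Implicit Defensive.
Import Order.TTheory GRing.Theory Num.Theory.
Local Open Scope ring_scope.

(** * Kernels and cokernels *)

(** No sheaf is ever twisted: a morphism to O(n) is treated as a map from the sections over U01 to
    the field k(x), and n only constrains its values. Dividing such a map by the equation of a point
    then lowers n, and cohomology enters through two computations with Laurent polynomials. The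
    inductions need numbers that drop: for the rank, the number of elements spanning the fibre at 0,
    and for torsion sheaves, the numbers of elements spanning the sections over the two charts over
    k. Both drop by the same elimination, [kspan_drop]. Two features of D shape the comparison. Its
    slices are only assumed closed under extensions, whereas generated subcategories are also closed
    under summands; [slice_between] bridges this. Moreover, distinct points may have the same phase
    in D, so the phases alone do not order the points, and an auxiliary linear order breaks the
    ties. *)

Definition mk_linear (R : pzRingType) (U : lmodType R) (V : zmodType)
    (s : GRing.Scale.law R V) (f : U -> V) (h : linear_for s f) :
    {linear U -> V | s} :=
  HB.pack f (GRing.isLinear.Build R U V s f h).

Section Modules.
Variable R : nzRingType.

Lemma linear_factor (A B C : lmodType R) (q : {linear A -> B})
    (f : {linear A -> C}) :
  (forall b, exists a, q a = b) -> (forall a, q a = 0 -> f a = 0) ->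
  exists g : {linear B -> C}, forall a, g (q a) = f a.
Proof.
move=> /choice[s qs] kqf.
have gq a : f (s (q a)) = f a.
  by apply/eqP; rewrite -subr_eq0 -linearB; apply/eqP/kqf; rewrite linearB qs subrr.
have lin : linear (f \o s).
  move=> r u v; rewrite /= -linearP -[in LHS](qs u) -[in LHS](qs v) -linearP.
  exact: gq.
by exists (mk_linear lin).
Qed.

Lemma linear_lift (A B C : lmodType R) (i : {linear B -> C})
    (f : {linear A -> C}) :
  injective i -> (forall a, exists b, i b = f a) ->
  exists g : {linear A -> B}, forall a, i (g a) = f a.
Proof.
move=> i_inj /choice[s is_].
have lin : linear s by move=> r u v; apply: i_inj; rewrite !linearP !is_ linearP.
by exists (mk_linear lin).
Qed.

Section Kernel.
Variables (M N : lmodType R) (f : {linear M -> N}).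

Definition ker_pred : {pred M} := fun m => f m == 0.

Fact ker_submod : submod_closed ker_pred.
Proof.
split=> [|a u v]; rewrite /in_mem /= /ker_pred ?linear0 //.
by move=> /eqP fu /eqP fv; rewrite linearP fu fv scaler0 addr0.
Qed.
HB.instance Definition _ := GRing.isSubmodClosed.Build R M ker_pred ker_submod.

Record ker : Type := Ker { ker_val : M; _ : ker_val \in ker_pred }.
HB.instance Definition _ := [isSub for ker_val].
HB.instance Definition _ := [Choice of ker by <:].
HB.instance Definition _ := [SubChoice_isSubLmodule of ker by <:].

Lemma ker_valP (m : ker) : f (ker_val m) = 0.
Proof. by case: m => m /= /eqP. Qed.

Lemma ker_ex m : f m = 0 -> exists m' : ker, ker_val m' = m.
Proof. by move=> /eqP fm; exists (Ker fm). Qed.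
End Kernel.

Section Cokernel.
Variables (M N : lmodType R) (f : {linear M -> N}).

Definition im_pred : {pred N} := fun n => `[< exists m, f m = n >].

Fact im_submod : submod_closed im_pred.
Proof.
split=> [|a u v]; first by apply/asboolP; exists 0; rewrite linear0.
move=> /asboolP[u' <-] /asboolP[v' <-]; apply/asboolP.
by exists (a *: u' + v'); rewrite linearP.
Qed.
HB.instance Definition _ := GRing.isSubmodClosed.Build R N im_pred im_submod.

Definition coker : Type := ring_quotient.Quotient.quot (im_pred : zmodClosed N).
HB.instance Definition _ := GRing.Zmodule.on coker.
Definition coker_pi (n : N) : coker := generic_quotient.pi coker n.

Fact coker_pi_is_zmod_morphism : zmod_morphism coker_pi.
Proof. exact: ring_quotient.pi_is_zmod_morphism. Qed.
HB.instance Definition _ :=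
  GRing.isZmodMorphism.Build N coker coker_pi coker_pi_is_zmod_morphism.

Lemma coker_surj (c : coker) : exists n, coker_pi n = c.
Proof. by exists (generic_quotient.repr c); exact: generic_quotient.reprK. Qed.

Lemma coker_pi_eq0 n : coker_pi n = 0 <-> exists m, f m = n.
Proof.
rewrite -(raddf0 coker_pi); split=> [/eqP|].
  by rewrite -ring_quotient.Quotient.idealrBE subr0 => /asboolP.
move=> ex; apply/eqP; rewrite -ring_quotient.Quotient.idealrBE subr0.
exact/asboolP.
Qed.

Definition coker_scale (a : R) (c : coker) : coker :=
  coker_pi (a *: generic_quotient.repr c).

Lemma coker_scale_pi a n : coker_scale a (coker_pi n) = coker_pi (a *: n).
Proof.
apply/eqP; rewrite -subr_eq0 -raddfB -scalerBr; apply/eqP/coker_pi_eq0.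
have /coker_pi_eq0[m fm] : coker_pi (generic_quotient.repr (coker_pi n) - n) = 0.
  by rewrite raddfB /= /coker_pi generic_quotient.reprK subrr.
by exists (a *: m); rewrite linearZ /= fm.
Qed.

Fact coker_scaleA a b c :
  coker_scale a (coker_scale b c) = coker_scale (a * b) c.
Proof. by have [n <-] := coker_surj c; rewrite !coker_scale_pi scalerA. Qed.
Fact coker_scale1 : left_id 1 coker_scale.
Proof.
by move=> c; have [n <-] := coker_surj c; rewrite coker_scale_pi scale1r.
Qed.
Fact coker_scaleDr : right_distributive coker_scale +%R.
Proof.
move=> a c d; have [n <-] := coker_surj c; have [m <-] := coker_surj d.
by rewrite -raddfD !coker_scale_pi -raddfD scalerDr.
Qed.
Fact coker_scaleDl c : {morph coker_scale^~ c : a b / a + b}.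
Proof.
move=> a b; have [n <-] := coker_surj c.
by rewrite !coker_scale_pi -raddfD scalerDl.
Qed.
HB.instance Definition _ := GRing.Zmodule_isLmodule.Build R coker
  coker_scaleA coker_scale1 coker_scaleDr coker_scaleDl.

Fact coker_pi_linear : linear coker_pi.
Proof. by move=> a u v; rewrite raddfD /= -coker_scale_pi. Qed.

Definition coker_proj : {linear N -> coker} := mk_linear coker_pi_linear.

Lemma coker_projE n : coker_proj n = coker_pi n. Proof. by []. Qed.

End Cokernel.
End Modules.

Section SemilinearMaps.
Variables (R S : nzRingType) (e : {rmorphism R -> S}) (x : R).
Variables (M N : lmodType R) (M' N' : lmodType S).
Variables (f : {linear M -> N}) (f' : {linear M' -> N'}).
Variables (rM : {linear M -> M' | e \; *:%R}).
Variables (rN : {linear N -> N' | e \; *:%R}).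
Hypothesis ff' : forall m, f' (rM m) = rN (f m).

Fact ker_map_subproof (m : ker f) : f' (rM (ker_val m)) == 0.
Proof. by rewrite ff' ker_valP linear0. Qed.
Definition ker_map_fun (m : ker f) : ker f' := Ker (ker_map_subproof m).
Fact ker_map_linear : linear_for (e \; *:%R) ker_map_fun.
Proof. by move=> a u v; apply: val_inj; rewrite /= linearP. Qed.
Definition ker_map : {linear ker f -> ker f' | e \; *:%R} :=
  mk_linear ker_map_linear.

Definition coker_map_fun (c : coker f) : coker f' :=
  coker_pi f' (rN (generic_quotient.repr c)).

Lemma coker_map_pi n : coker_map_fun (coker_pi f n) = coker_pi f' (rN n).
Proof.
apply/eqP; rewrite -subr_eq0 -!raddfB; apply/eqP/coker_pi_eq0.
set n' := generic_quotient.repr _.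
have /coker_pi_eq0[m fm] : coker_pi f (n' - n) = 0.
  by rewrite raddfB /= /coker_pi generic_quotient.reprK subrr.
by exists (rM m); rewrite ff' fm.
Qed.

Fact coker_map_linear : linear_for (e \; *:%R) coker_map_fun.
Proof.
move=> a u v; have [m <-] := coker_surj u; have [n <-] := coker_surj v.
by rewrite -!coker_projE -linearP !coker_projE !coker_map_pi linearP /= -!coker_projE linearP.
Qed.
Definition coker_map : {linear coker f -> coker f' | e \; *:%R} :=
  mk_linear coker_map_linear.

Hypotheses (locM : is_localization x rM) (locN : is_localization x rN).

(** Localization is exact. Up to a power of x, an element of [ker f'] comes from some m in M; then f
    m dies under [rN], so some x^j kills it and x^j m lies in [ker f]. *)
Lemma ker_map_loc : is_localization x ker_map.
Proof.
split=> [m /(congr1 (@ker_val _ _ _ _)) /= m0|s].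
  have [n xm] := locM.1 _ m0.
  by exists n; apply: val_inj; rewrite /= xm.
have [n [m xs]] := locM.2 (ker_val s).
have /locN.1[j xfm] : rN (f m) = 0.
  by rewrite -ff' -xs linearZ /= ker_valP scaler0.
have [m' m'E] : exists m' : ker f, ker_val m' = x ^+ j *: m.
  by apply: ker_ex; rewrite linearZ.
exists (j + n)%N, m'; apply: val_inj.
by rewrite /= m'E exprD rmorphM -scalerA xs linearZ.
Qed.

(** If [rN n] is in the image of [f'], clearing the denominator of a preimage gives x^j n - f m that
    dies under [rN], and a further power of x kills it. *)
Lemma coker_map_loc : is_localization x coker_map.
Proof.
split=> [c|c].
  have [n <-] := coker_surj c.
  rewrite [coker_map _]coker_map_pi => /coker_pi_eq0[m' fm'].
  have [j [m xm']] := locM.2 m'.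
  have /locN.1[i xi] : rN (x ^+ j *: n - f m) = 0.
    by rewrite linearB linearZ /= -ff' -xm' linearZ /= fm' subrr.
  exists (i + j)%N; rewrite -coker_projE -linearZ; apply/coker_pi_eq0.
  exists (x ^+ i *: m); rewrite linearZ /=; apply/esym/eqP.
  by rewrite exprD -scalerA -subr_eq0 -scalerBr xi.
have [n <-] := coker_surj c; have [j [m xn]] := locN.2 n.
exists j, (coker_proj f m).
by rewrite [coker_map _]coker_map_pi -xn -!coker_projE linearZ.
Qed.
End SemilinearMaps.

Lemma fg_surj (R : nzRingType) (M N : lmodType R) (q : {linear M -> N}) :
  (forall n, exists m, q m = n) -> finitely_generated M -> finitely_generated N.
Proof.
move=> q_surj [n [g gen]]; exists n, (q \o g) => b.
have [m <-] := q_surj b; have [c ->] := gen m.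
by exists c; rewrite linear_sum; apply: eq_bigr => i _; rewrite linearZ.
Qed.

Section Category.
Variable k : fieldType.
Implicit Types F G H : coh k.

Definition comp_hom F G H (g : coh_hom G H) (f : coh_hom F G) : coh_hom F H.
Proof.
apply: (@CohHom k F H (hom0 g \o hom0 f) (hom1 g \o hom1 f) (hom01 g \o hom01 f)).
- by move=> m; rewrite /= !hom_res0.
- by move=> m; rewrite /= !hom_res1.
Defined.

Definition id_hom F : coh_hom F F :=
  @CohHom k F F idfun idfun idfun (fun=> erefl) (fun=> erefl).

Definition zero_hom F G : coh_hom F G.
Proof.
apply: (@CohHom k F G \0 \0 \0) => m /=; by rewrite linear0.
Defined.

Definition hom_inj F G (f : coh_hom F G) : Prop :=
  [/\ injective (hom0 f), injective (hom1 f) & injective (hom01 f)].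

Definition hom_surj F G (f : coh_hom F G) : Prop :=
  [/\ forall n, exists m, hom0 f m = n, forall n, exists m, hom1 f m = n
    & forall n, exists m, hom01 f m = n].

Lemma xVXn n : laurent_xV k ^+ n * chart0 'X ^+ n = 1.
Proof. by rewrite -exprMn_comm ?laurent_xVx ?expr1n //; apply: mulrC. Qed.

(** As x is invertible on U01, the denominator can change sides. This form reduces most questions
    about U01 to U0. *)
Lemma sec01_repr0 F (s : sec01 F) :
  exists n m, s = laurent_xV k ^+ n *: res0 F m.
Proof.
have [n [m xs]] := (coh_loc0 F).2 s; exists n, m.
by rewrite -xs scalerA rmorphXn xVXn scale1r.
Qed.

Lemma sec01_repr1 F (s : sec01 F) :
  exists n m, s = chart0 'X ^+ n *: res1 F m.
Proof.
have [n [m xs]] := (coh_loc1 F).2 s; exists n, m.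
by rewrite -xs scalerA rmorphXn /= chart1X mulrC xVXn scale1r.
Qed.

Lemma sec01_mulX0 F (s : sec01 F) n : chart0 'X ^+ n *: s = 0 -> s = 0.
Proof.
by move/(congr1 ( *:%R (laurent_xV k ^+ n))); rewrite scalerA xVXn scale1r scaler0.
Qed.

Lemma sec01_mulxV0 F (s : sec01 F) n : laurent_xV k ^+ n *: s = 0 -> s = 0.
Proof.
move/(congr1 ( *:%R (chart0 'X ^+ n))).
by rewrite scalerA mulrC xVXn scale1r scaler0.
Qed.

Lemma hom01_surj F G (f : coh_hom F G) :
  (forall n, exists m, hom0 f m = n) -> forall n, exists m, hom01 f m = n.
Proof.
move=> f0 s; have [n [m ->]] := sec01_repr0 s; have [m' <-] := f0 m.
by exists (laurent_xV k ^+ n *: res0 F m'); rewrite linearZ /= hom_res0.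
Qed.

Lemma hom01_eq0 F G (f : coh_hom F G) :
  (forall m, hom0 f m = 0) -> forall m, hom01 f m = 0.
Proof.
move=> f0 s; have [n [m ->]] := sec01_repr0 s.
by rewrite linearZ /= hom_res0 f0 linear0 scaler0.
Qed.

Lemma hom01_eq0_from1 F G (f : coh_hom F G) :
  (forall m, hom1 f m = 0) -> forall m, hom01 f m = 0.
Proof.
move=> f0 s; have [n [m ->]] := sec01_repr1 s.
by rewrite linearZ /= hom_res1 f0 linear0 scaler0.
Qed.

Lemma sec01_zero F : (forall m : sec0 F, m = 0) -> forall m : sec01 F, m = 0.
Proof. exact: (hom01_eq0 (f := id_hom F)). Qed.

Lemma is_zero01 F : (forall m : sec0 F, m = 0) -> (forall m : sec1 F, m = 0) ->
  is_zero F.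
Proof. by move=> h0 h1; split=> //; apply: sec01_zero. Qed.

Lemma hom_is_zero01 F G (f : coh_hom F G) :
  (forall m, hom0 f m = 0) -> (forall m, hom1 f m = 0) -> hom_is_zero f.
Proof. by move=> h0 h1; split=> //; apply: hom01_eq0. Qed.

(** Finite generation of the kernels is an argument, supplied at each use: from a finite span over k
    when F is torsion, and from a splitting over each chart when G is a line bundle. *)
Definition sub_coh F G (f : coh_hom F G)
  (fg0 : finitely_generated (ker (hom0 f)))
  (fg1 : finitely_generated (ker (hom1 f))) : coh k :=
  Coh fg0 fg1 (ker_map_loc (@hom_res0 _ _ _ f) (coh_loc0 F) (coh_loc0 G))
    (ker_map_loc (@hom_res1 _ _ _ f) (coh_loc1 F) (coh_loc1 G)).

Fact ker_val_linear (R : nzRingType) (M N : lmodType R) (f : {linear M -> N}) :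
  linear (@ker_val R M N f).
Proof. by []. Qed.

Definition sub_incl F G (f : coh_hom F G) fg0 fg1 :
  coh_hom (@sub_coh F G f fg0 fg1) F :=
  @CohHom k (@sub_coh F G f fg0 fg1) F
    (mk_linear (ker_val_linear (f := hom0 f)))
    (mk_linear (ker_val_linear (f := hom1 f)))
    (mk_linear (ker_val_linear (f := hom01 f))) (fun=> erefl) (fun=> erefl).

Lemma ker_short_exact (R : nzRingType) (M N : lmodType R) (f : {linear M -> N}) :
  (forall n, exists m, f m = n) ->
  short_exact_map (@ker_val R M N f) f.
Proof.
move=> fs; split=> [|//|m]; first exact: val_inj.
by split=> [/ker_ex|[m' <-]] //; apply: ker_valP.
Qed.

Definition quot_coh F G (f : coh_hom F G) : coh k :=
  Coh (fg_surj (@coker_surj _ _ _ (hom0 f) : forall n, exists m, coker_proj _ m = n) (coh_fg0 G))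
    (fg_surj (@coker_surj _ _ _ (hom1 f) : forall n, exists m, coker_proj _ m = n) (coh_fg1 G))
    (coker_map_loc (@hom_res0 _ _ _ f) (coh_loc0 F) (coh_loc0 G))
    (coker_map_loc (@hom_res1 _ _ _ f) (coh_loc1 F) (coh_loc1 G)).

Definition quot_proj F G (f : coh_hom F G) : coh_hom G (quot_coh f) :=
  @CohHom k G (quot_coh f) (coker_proj (hom0 f)) (coker_proj (hom1 f))
    (coker_proj (hom01 f)) 
    (fun m => esym (coker_map_pi (@hom_res0 _ _ _ f) m))
    (fun m => esym (coker_map_pi (@hom_res1 _ _ _ f) m)).

Lemma coker_short_exact (R : nzRingType) (M N : lmodType R)
    (f : {linear M -> N}) :
  injective f -> short_exact_map f (coker_proj f).
Proof. by move=> fi; split=> // [c|n]; [apply: coker_surj|apply: coker_pi_eq0]. Qed.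

Lemma cokernel_exact F G (f : coh_hom F G) : hom_inj f ->
  exists (C : coh k) (q : coh_hom G C), short_exact f q.
Proof.
move=> [i0 i1 i01]; exists (quot_coh f), (quot_proj f).
by split; apply: coker_short_exact.
Qed.

Lemma hom_factor F G H (q : coh_hom F G) (f : coh_hom F H) :
  hom_surj q -> (forall m, hom0 q m = 0 -> hom0 f m = 0) ->
  (forall m, hom1 q m = 0 -> hom1 f m = 0) ->
  exists g : coh_hom G H,
    (forall m, hom0 g (hom0 q m) = hom0 f m) /\
    (forall m, hom1 g (hom1 q m) = hom1 f m).
Proof.
move=> [s0 s1 s01] k0 k1.
(* Without its denominator, a section killed by [hom01 q] is the restriction of some m' over U0, and
   [hom0 q] kills a multiple X^j m', to which [k0] applies. *)
have k01 m : hom01 q m = 0 -> hom01 f m = 0.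
  have [n [m' ->]] := sec01_repr0 m; rewrite !linearZ /= !hom_res0.
  move=> /sec01_mulxV0/(coh_loc0 G).1[j].
  rewrite -linearZ => /k0; rewrite linearZ => /(congr1 (res0 H)).
  rewrite linear0 linearZ /= rmorphXn => /sec01_mulX0 ->.
  by rewrite scaler0.
have [g0 g0E] := linear_factor s0 k0.
have [g1 g1E] := linear_factor s1 k1.
have [g01 g01E] := linear_factor s01 k01.
unshelve eexists (@CohHom k G H g0 g1 g01 _ _); last by [].
- by move=> b; have [a <-] := s0 b; rewrite g0E -!hom_res0 g01E.
- by move=> b; have [a <-] := s1 b; rewrite g1E -!hom_res1 g01E.
Qed.

Lemma hom_lift F G H (i : coh_hom G H) (f : coh_hom F H) :
  hom_inj i -> (forall m, exists m', hom0 i m' = hom0 f m) ->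
  (forall m, exists m', hom1 i m' = hom1 f m) ->
  exists g : coh_hom F G,
    (forall m, hom0 i (hom0 g m) = hom0 f m) /\
    (forall m, hom1 i (hom1 g m) = hom1 f m).
Proof.
move=> [i0 i1 i01] l0 l1.
have l01 m : exists m', hom01 i m' = hom01 f m.
  have [n [m' ->]] := sec01_repr0 m; have [m'' e] := l0 m'.
  exists (laurent_xV k ^+ n *: res0 G m'').
  by rewrite !linearZ /= !hom_res0 e.
have [g0 g0E] := linear_lift i0 l0.
have [g1 g1E] := linear_lift i1 l1.
have [g01 g01E] := linear_lift i01 l01.
unshelve eexists (@CohHom k F G g0 g1 g01 _ _); last by [].
- by move=> b; apply: i01; rewrite g01E !hom_res0 g0E.
- by move=> b; apply: i01; rewrite g01E !hom_res1 g1E.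
Qed.
End Category.

(** * Exact sequences and vanishing of Hom *)

Section Exactness.
Variable k : fieldType.
Implicit Types A B C F G H : coh k.

Lemma res0Z F p m : res0 F (p *: m) = chart0 p *: res0 F m.
Proof. exact: linearZ_LR. Qed.

Lemma res1Z F p m : res1 F (p *: m) = chart1 p *: res1 F m.
Proof. exact: linearZ_LR. Qed.

Lemma res0_eq0 F (m : sec0 F) : res0 F m = 0 <-> exists j, 'X^j *: m = 0.
Proof.
split=> [|[j xm]]; first exact: (coh_loc0 F).1.
by apply: (@sec01_mulX0 _ _ _ j); rewrite -rmorphXn -res0Z xm linear0.
Qed.

Lemma hom01_eq F G (f g : coh_hom F G) : hom0 f =1 hom0 g -> hom01 f =1 hom01 g.
Proof.
move=> fg s; have [n [m ->]] := sec01_repr0 s.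
by rewrite !linearZ /= !hom_res0 fg.
Qed.

(** The sections over U01 are a localization of those over U0, so exactness over U0 implies
    exactness over U01. *)
Lemma short_exact01 A B C (i : coh_hom A B) (q : coh_hom B C) :
  short_exact_map (hom0 i) (hom0 q) -> short_exact_map (hom1 i) (hom1 q) ->
  short_exact i q.
Proof.
move=> [i0 s0 e0] se1; split=> //; split.
- suff inj s : hom01 i s = 0 -> s = 0 by apply: raddf_inj; apply: inj.
  have [n [m ->]] := sec01_repr0 s; rewrite linearZ /= hom_res0.
  move=> /sec01_mulxV0/res0_eq0[j].
  rewrite -linearZ -(linear0 (hom0 i)) => /i0 xm.
  have /res0_eq0 -> : exists j, 'X^j *: m = 0 by exists j.
  by rewrite scaler0.
- exact: hom01_surj.
move=> s; split=> [|[t <-]]; last first.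
  have [n [m ->]] := sec01_repr0 t; rewrite !linearZ /= !hom_res0.
  by have -> : hom0 q (hom0 i m) = 0 by [apply/e0; exists m]; rewrite linear0 scaler0.
have [n [m ->]] := sec01_repr0 s; rewrite linearZ /= hom_res0.
move=> /sec01_mulxV0/res0_eq0[j].
rewrite -linearZ => /e0[a ia].
exists (laurent_xV k ^+ n *: (laurent_xV k ^+ j *: res0 A a)).
rewrite !linearZ /= hom_res0 ia res0Z rmorphXn !scalerA -mulrA xVXn.
by rewrite mulr1.
Qed.

Lemma short_exact_inj A B C (i : coh_hom A B) (q : coh_hom B C) :
  short_exact i q -> hom_inj i.
Proof. by case=> [[? _ _] [? _ _] [? _ _]]. Qed.

Lemma short_exact_surj A B C (i : coh_hom A B) (q : coh_hom B C) :
  short_exact i q -> hom_surj q.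
Proof. by case=> [[_ ? _] [_ ? _] [_ ? _]]. Qed.

Lemma short_exact_comp A B C (i : coh_hom A B) (q : coh_hom B C) :
  short_exact i q -> hom_is_zero (comp_hom q i).
Proof.
by case=> [[_ _ e0] [_ _ e1] [_ _ e01]]; split=> m; [apply/e0|apply/e1|apply/e01];
  exists m.
Qed.

Lemma comp_inj A B C (g : coh_hom B C) (f : coh_hom A B) :
  hom_inj g -> hom_inj f -> hom_inj (comp_hom g f).
Proof. by move=> [? ? ?] [? ? ?]; split; apply: inj_comp. Qed.

Lemma comp_surj A B C (g : coh_hom B C) (f : coh_hom A B) :
  hom_surj g -> hom_surj f -> hom_surj (comp_hom g f).
Proof.
move=> [g0 g1 g01] [f0 f1 f01]; split=> c.
- by have [b <-] := g0 c; have [a <-] := f0 b; exists a.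
- by have [b <-] := g1 c; have [a <-] := f1 b; exists a.
- by have [b <-] := g01 c; have [a <-] := f01 b; exists a.
Qed.

Lemma id_inj A : hom_inj (id_hom A). Proof. by split. Qed.

Lemma id_surj A : hom_surj (id_hom A). Proof. by split=> m; exists m. Qed.

Lemma cancel_inj A B (f : coh_hom A B) (g : coh_hom B A) :
  cancel_hom f g -> hom_inj f.
Proof. by case=> c0 c1 c01; split; [apply: can_inj c0|apply: can_inj c1|apply: can_inj c01]. Qed.

Lemma cancel_surj A B (f : coh_hom A B) (g : coh_hom B A) :
  cancel_hom f g -> hom_surj g.
Proof.
case=> c0 c1 c01; split=> m.
- by exists (hom0 f m).
- by exists (hom1 f m).
- by exists (hom01 f m).
Qed.

Lemma inj_surj_iso A B (f : coh_hom A B) : hom_inj f -> hom_surj f -> coh_iso A B.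
Proof.
move=> fi [s0 s1 s01].
have [g [g0 g1]] := hom_lift (f := id_hom B) fi s0 s1.
have g01 := @hom01_eq _ _ (comp_hom f g) (id_hom B) g0.
have [i0 i1 i01] := fi.
exists f, g; split; split=> m.
- exact: (i0 _ _ (g0 _)).
- exact: (i1 _ _ (g1 _)).
- exact: (i01 _ _ (g01 _)).
- exact: (g0 m).
- exact: (g1 m).
- exact: (g01 m).
Qed.

Lemma coh_iso_sym A B : coh_iso A B -> coh_iso B A.
Proof. by move=> [f [g [fg gf]]]; exists g, f. Qed.

Lemma coh_iso_inj A B : coh_iso A B -> exists f : coh_hom A B, hom_inj f /\ hom_surj f.
Proof.
by move=> [f [g [fg gf]]]; exists f; split;
  [apply: cancel_inj fg|apply: cancel_surj gf].
Qed.

Lemma inj_is_zero A B (f : coh_hom A B) : hom_inj f -> is_zero B -> is_zero A.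
Proof.
move=> [i0 i1 i01] [z0 z1 z01]; split=> m; [apply: i0|apply: i1|apply: i01].
- by rewrite (z0 (hom0 f m)) linear0.
- by rewrite (z1 (hom1 f m)) linear0.
- by rewrite (z01 (hom01 f m)) linear0.
Qed.

Lemma surj_is_zero A B (f : coh_hom A B) : hom_surj f -> is_zero A -> is_zero B.
Proof.
move=> [i0 i1 i01] [z0 z1 z01]; split=> m.
- by have [a <-] := i0 m; rewrite (z0 a) linear0.
- by have [a <-] := i1 m; rewrite (z1 a) linear0.
- by have [a <-] := i01 m; rewrite (z01 a) linear0.
Qed.

Lemma inj_zero_hom A B (f : coh_hom A B) : hom_inj f -> hom_is_zero f -> is_zero A.
Proof.
move=> [i0 i1 i01] [z0 z1 z01]; split=> m; [apply: i0|apply: i1|apply: i01].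
- by rewrite z0 linear0.
- by rewrite z1 linear0.
- by rewrite z01 linear0.
Qed.

Lemma surj_zero_hom A B (f : coh_hom A B) : hom_surj f -> hom_is_zero f -> is_zero B.
Proof.
move=> [i0 i1 i01] [z0 z1 z01]; split=> m.
- by have [a <-] := i0 m.
- by have [a <-] := i1 m.
- by have [a <-] := i01 m.
Qed.

Lemma comp_zero_inj A B C (i : coh_hom B C) (f : coh_hom A B) :
  hom_inj i -> hom_is_zero (comp_hom i f) -> hom_is_zero f.
Proof.
move=> [i0 i1 _] [z0 z1 _]; apply: hom_is_zero01 => m;
  by [apply: i0; rewrite linear0; apply: z0|apply: i1; rewrite linear0; apply: z1].
Qed.

Lemma comp_zero_surj A B C (f : coh_hom B C) (q : coh_hom A B) :
  hom_surj q -> hom_is_zero (comp_hom f q) -> hom_is_zero f.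
Proof.
move=> [s0 s1 _] [z0 z1 _]; apply: hom_is_zero01 => m.
- by have [m' <-] := s0 m; apply: z0.
- by have [m' <-] := s1 m; apply: z1.
Qed.

Lemma short_exact_zero_iso A B C (i : coh_hom A B) (q : coh_hom B C) :
  short_exact i q -> is_zero A -> coh_iso B C.
Proof.
move=> se [a0 a1 a01]; apply: (inj_surj_iso (f := q)); last exact: short_exact_surj se.
case: se => [[_ _ e0] [_ _ e1] [_ _ e01]].
split; apply: raddf_inj => m.
- by move=> /(e0 _).1[u <-]; rewrite (a0 u) linear0.
- by move=> /(e1 _).1[u <-]; rewrite (a1 u) linear0.
- by move=> /(e01 _).1[u <-]; rewrite (a01 u) linear0.
Qed.

Lemma short_exact_comp_iso A A' B C (i : coh_hom A B) (q : coh_hom B C)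
    (f : coh_hom A' A) :
  short_exact i q -> hom_inj f -> hom_surj f -> short_exact (comp_hom i f) q.
Proof.
move=> [[i0 s0 e0] [i1 s1 e1] _] [f0 f1 _] [g0 g1 _].
apply: short_exact01; split=> //; try by apply: inj_comp.
- move=> b; rewrite e0; split=> [[a <-]|[a <-]]; last by exists (hom0 f a).
  by have [a' <-] := g0 a; exists a'.
- move=> b; rewrite e1; split=> [[a <-]|[a <-]]; last by exists (hom1 f a).
  by have [a' <-] := g1 a; exists a'.
Qed.

Lemma factor_short_exact (R : nzRingType) (A'' A' A Q C E : lmodType R)
  (i' : {linear A'' -> A'}) (q' : {linear A' -> Q})
  (i : {linear A' -> A}) (q : {linear A -> E})
  (p : {linear A -> C}) (u : {linear Q -> C}) (v : {linear C -> E}) :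
  short_exact_map i' q' -> short_exact_map i q ->
  short_exact_map (i \o i') p ->
  (forall m, u (q' m) = p (i m)) -> (forall m, v (p m) = q m) ->
  short_exact_map u v.
Proof.
move=> [i'_inj q's ex'] [i_inj qs ex] [_ ps exp] uE vE; split.
- suff inj c : u c = 0 -> c = 0 by apply: raddf_inj; apply: inj.
  have [a <-] := q's c; rewrite uE => /exp[b /i_inj <-].
  by apply/ex'; exists b.
- by move=> w; have [a <-] := qs w; exists (p a).
move=> c; split=> [|[b <-]].
  have [a <-] := ps c; rewrite vE => /ex[b <-]; exists (q' b); exact: uE.
by have [a <-] := q's b; rewrite uE vE; apply/ex; exists a.
Qed.

(** Here C is A / A''. This merges two consecutive factors Q = A' / A'' and E = A / A' of a
    filtration into one. *)
Lemma third_iso A'' A' A Q E (i' : coh_hom A'' A') (q' : coh_hom A' Q)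
    (i : coh_hom A' A) (q : coh_hom A E) :
  short_exact i' q' -> short_exact i q ->
  exists C (p : coh_hom A C) (u : coh_hom Q C) (v : coh_hom C E),
    short_exact (comp_hom i i') p /\ short_exact u v.
Proof.
move=> se' se.
have [C [p sep]] :=
  cokernel_exact (comp_inj (short_exact_inj se) (short_exact_inj se')).
have [se'0 se'1 _] := se'; have [se0 se1 _] := se; have [sep0 sep1 _] := sep.
have [u [u0 u1]] : exists u : coh_hom Q C,
    (forall m, hom0 u (hom0 q' m) = hom0 (comp_hom p i) m) /\
    (forall m, hom1 u (hom1 q' m) = hom1 (comp_hom p i) m).
  apply: hom_factor; first exact: short_exact_surj se'.
  - case: se'0 sep0 => _ _ ex' [_ _ ex] m /ex'[a <-].
    by apply/ex; exists a.
  - case: se'1 sep1 => _ _ ex' [_ _ ex] m /ex'[a <-].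
    by apply/ex; exists a.
have [v [v0 v1]] : exists v : coh_hom C E,
    (forall m, hom0 v (hom0 p m) = hom0 q m) /\
    (forall m, hom1 v (hom1 p m) = hom1 q m).
  apply: hom_factor; first exact: short_exact_surj sep.
  - case: se0 sep0 => _ _ ex' [_ _ ex] m /ex[a <-].
    by apply/ex'; exists (hom0 i' a).
  - case: se1 sep1 => _ _ ex' [_ _ ex] m /ex[a <-].
    by apply/ex'; exists (hom1 i' a).
exists C, p, u, v; split=> //; apply: short_exact01.
- exact: factor_short_exact se'0 se0 sep0 u0 v0.
- exact: factor_short_exact se'1 se1 sep1 u1 v1.
Qed.

Definition vanish F G : Prop := forall f : coh_hom F G, hom_is_zero f.

Lemma vanish_surj A B G (q : coh_hom A B) : hom_surj q -> vanish A G -> vanish B G.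
Proof.
move=> [s0 s1 _] vA f; have [z0 z1 _] := vA (comp_hom f q).
apply: hom_is_zero01 => m.
- by have [a <-] := s0 m; apply: z0.
- by have [a <-] := s1 m; apply: z1.
Qed.

Lemma vanish_inj A B F (i : coh_hom A B) : hom_inj i -> vanish F B -> vanish F A.
Proof.
move=> [i0 i1 _] vB f; have [z0 z1 _] := vB (comp_hom i f).
by apply: hom_is_zero01 => m; [apply: i0|apply: i1]; rewrite linear0;
  [apply: z0|apply: z1].
Qed.

Lemma vanish_generatedl S F G : (forall A, S A -> vanish A G) ->
  generated S F -> vanish F G.
Proof.
move=> vS; elim=> {F} [F /vS//|A B /coh_iso_inj[f [_ fs]] _|A B C i q se _ vA _ vC
  |A B [C [i [q [p [se ip]]]]] _].
- exact: vanish_surj fs.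
- move=> f; have [[_ _ e0] [_ _ e1] _] := se.
  have [z0 z1 _] := vA (comp_hom f i).
  have [g [g0 g1]] : exists g : coh_hom C G,
      (forall m, hom0 g (hom0 q m) = hom0 f m) /\
      (forall m, hom1 g (hom1 q m) = hom1 f m).
    apply: hom_factor; first exact: short_exact_surj se.
    - by move=> m /e0[a <-]; apply: z0.
    - by move=> m /e1[a <-]; apply: z1.
  have [y0 y1 _] := vC g.
  by apply: hom_is_zero01 => m; rewrite -?g0 -?g1.
- exact: vanish_surj (cancel_surj ip).
Qed.

Lemma vanish_generatedr S F G : (forall A, S A -> vanish F A) ->
  generated S G -> vanish F G.
Proof.
move=> vS; elim=> {G} [G /vS//|A B /coh_iso_sym/coh_iso_inj[f [fi _]] _
  |A B C i q se _ vA _ vC |A B [C [i [q [p [se ip]]]]] _].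
- exact: vanish_inj fi.
- move=> f; have [[_ _ e0] [_ _ e1] _] := se.
  have [z0 z1 _] := vC (comp_hom q f).
  have [g [g0 g1]] : exists g : coh_hom F A,
      (forall m, hom0 i (hom0 g m) = hom0 f m) /\
      (forall m, hom1 i (hom1 g m) = hom1 f m).
    apply: hom_lift; first exact: short_exact_inj se.
    - by move=> m; apply/e0/z0.
    - by move=> m; apply/e1/z1.
  have [y0 y1 _] := vA g.
  by apply: hom_is_zero01 => m; rewrite -?g0 -?g1 ?y0 ?y1 linear0.
- exact: vanish_inj (cancel_inj ip).
Qed.

(** Through [generated_summand] this puts the zero sheaves into every subcategory generated by a
    nonempty family. *)
Lemma zero_direct_summand F G : is_zero F -> direct_summand F G.
Proof.
move=> [z0 z1 z01]; exists G, (zero_hom F G), (id_hom G), (zero_hom G F).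
split; last by split=> m /=; [rewrite (z0 m)|rewrite (z1 m)|rewrite (z01 m)].
apply: short_exact01; split=> /=.
- by move=> u v _; rewrite (z0 u) (z0 v).
- by move=> w; exists w.
- by move=> w; split=> [->|[? <-]//]; exists 0.
- by move=> u v _; rewrite (z1 u) (z1 v).
- by move=> w; exists w.
- by move=> w; split=> [->|[? <-]//]; exists 0.
Qed.
End Exactness.

(** * Harder-Narasimhan filtrations *)

Section StabilityData.
Variables (k : fieldType) (D : slicing k).
Hypothesis Dst : is_stability_data D.
Implicit Types F G A B : coh k.

Lemma hom_phase_le (a b : phase D) F G (f : coh_hom F G) :
  slice a F -> slice b G -> ~ hom_is_zero f -> phase_le a b.
Proof.
move=> Fa Gb nz; apply: contra_notT nz => ab.
exact: (stab_hom Dst f ab).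
Qed.

(** All later arguments use only the two ends of the filtration: its first step A and its last
    factor B. If it has more than one step, A lies in the last proper step, which is the kernel of
    the map to B. *)
Lemma HN_ends F : ~ is_zero F ->
  exists (a b : phase D) A B (i : coh_hom A F) (q : coh_hom F B),
  [/\ slice a A /\ slice b B, hom_inj i /\ hom_surj q,
      ~ is_zero A, ~ is_zero B
    & (a = b /\ slice a F) \/ (phase_lt b a /\ hom_is_zero (comp_hom q i))].
Proof.
move=> F0; have [[|n] [X [Q [phi [X0 XF fil ord]]]]] := stab_HN Dst F0.
  by have [f [_ /surj_is_zero fs]] := coh_iso_inj XF; case: F0; apply: fs.
have [[i0 [q0 se0]] [Q0nz Q0]] := fil 0%N isT.
have iso1 := short_exact_zero_iso se0 X0.
have X1s : slice (phi 0%N) (X 1%N) := stab_iso Dst (coh_iso_sym iso1) Q0.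
have X1nz : ~ is_zero (X 1%N).
  by have [g [_ gs]] := coh_iso_inj iso1 => /(surj_is_zero gs).
have chain j : (j < n.+1)%N -> exists i : coh_hom (X 1%N) (X j.+1), hom_inj i.
  elim: j => [|j IH] jn; first by exists (id_hom _); exact: id_inj.
  have [i ii] := IH (ltnW jn).
  have [[i' [q' se']] _] := fil j.+1 jn.
  by exists (comp_hom i' i); apply: comp_inj => //; apply: short_exact_inj se'.
have [i ii] := chain n (ltnSn n).
have [[i' [q' se']] [Qnz Qs]] := fil n (ltnSn n).
have [f [g [fg gf]]] := XF.
exists (phi 0%N), (phi n), (X 1%N), (Q n).
case: n => [|n] in XF fil ord chain i ii i' q' se' Qnz Qs f g fg gf *.
  exists (comp_hom f i), (comp_hom q' g); split=> //.
    split; first by apply: comp_inj => //; apply: cancel_inj fg.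
    apply: comp_surj; [exact: short_exact_surj se'|exact: cancel_surj fg].
  by left; split=> //; exact: stab_iso XF X1s.
have [j ji] := chain n (leqnSn _).
exists (comp_hom f (comp_hom i' j)), (comp_hom q' g); split=> //.
  split; first apply: comp_inj; first exact: cancel_inj fg.
    by apply: comp_inj => //; apply: short_exact_inj se'.
  apply: comp_surj; [exact: short_exact_surj se'|exact: cancel_surj fg].
right; split; first by apply: ord; rewrite ltn0Sn ltnSn.
have [z0 z1 _] := short_exact_comp se'; have [c0 c1 _] := fg.
by apply: hom_is_zero01 => m; rewrite /= ?c0 ?c1; [apply: z0|apply: z1].
Qed.

(** With A and B the ends of F, of phases b and c, the nonzero maps A -> F -> G and H -> F -> B give
    b <= a <= c, which excludes b > c. The case G = H shows that slices are closed under direct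
    summands. *)
Lemma slice_between (a : phase D) F G H (i : coh_hom F G) (q : coh_hom H F) :
  hom_inj i -> hom_surj q -> slice a G -> slice a H -> slice a F.
Proof.
move=> ii qs Ga Ha; have [F0|F0] := pselect (is_zero F).
  exact: stab_zero.
have [b [c [A [B [j [p [[Ab Bc] [ji ps] A0 B0 cs]]]]]]] := HN_ends F0.
have ba : phase_le b a.
  apply: (hom_phase_le (f := comp_hom i j)) => // z; apply: A0.
  exact: inj_zero_hom (comp_inj ii ji) z.
have ac : phase_le a c.
  apply: (hom_phase_le (f := comp_hom p q)) => // z; apply: B0.
  exact: surj_zero_hom (comp_surj ps qs) z.
have [_ anti trans _] := stab_order Dst.
case: cs => [[bc Fb]|[]]; last by rewrite /phase_lt (trans _ _ _ ba ac).
have -> // : a = b by apply: anti; rewrite ba {1}bc ac.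
Qed.

Lemma generated_slice (a : phase D) (S : subcategory k) F :
  (forall A, S A -> slice a A) -> generated S F -> slice a F.
Proof.
move=> sub; elim=> {F} [F /sub//|A B AB _|A B C i q se _ As _ Cs
  |A B [C [i [q [p [se ip]]]]] _ Bs].
- exact: stab_iso AB.
- exact: stab_ext se As Cs.
- exact: (slice_between (cancel_inj ip) (cancel_surj ip) Bs Bs).
Qed.

(** If the filtration had several steps, the inclusion of A would be onto by simplicity, and the
    composite A -> F -> B both zero and onto. *)
Lemma simple_semistable F : ~ is_zero F ->
  (forall A (i : coh_hom A F), ~ hom_is_zero i -> hom_surj i) ->
  exists a : phase D, slice a F.
Proof.
move=> F0 simple; have [b [c [A [B [j [p [[Ab Bc] [ji ps] A0 B0 cs]]]]]]] := HN_ends F0.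
case: cs => [[_ Fb]|[_ z]]; first by exists b.
have js : hom_surj j by apply: simple => z'; exact/A0/inj_zero_hom/z'.
by case: B0; exact: surj_zero_hom (comp_surj ps js) z.
Qed.
End StabilityData.

(** * Stability data defined by a linearly ordered family of sheaves *)

Section Filtrations.
Variables (k : fieldType) (T : Type) (leT : rel T) (E : T -> coh k).
Hypothesis leT_order : linear_order leT.
Implicit Types F G A B : coh k.

(* Factors listed from the top quotient down. *)
Inductive filtered : seq T -> coh k -> Prop :=
| filtered_nil F of is_zero F : filtered [::] F
| filtered_cons b s F' F (i : coh_hom F' F) (q : coh_hom F (E b)) of
    short_exact i q & filtered s F' : filtered (b :: s) F.

(** The Harder-Narasimhan form of [filtered]: equal indices are merged, and a factor may be any
    nonzero member of the subcategory generated by [E b]. *)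
Inductive strictly_filtered : seq T -> coh k -> Prop :=
| strictly_filtered_nil F of is_zero F : strictly_filtered [::] F
| strictly_filtered_cons b s F' F Q (i : coh_hom F' F) (q : coh_hom F Q) of
    short_exact i q & generated (eq (E b)) Q & ~ is_zero Q
    & all (fun c => ~~ leT c b) s & strictly_filtered s F' :
    strictly_filtered (b :: s) F.

Definition family_slicing : slicing k :=
  Slicing leT (fun b => generated (eq (E b))).

(** The last clause is the induction invariant: it makes all phases of F' exceed that of the top
    factor, which is appended at the end. The phase [t] is a default for the empty filtration. *)
Lemma strictly_filtered_HN (t : T) s F : strictly_filtered s F ->
  exists (n : nat) (X Q : nat -> coh k) (phi : nat -> T),
    [/\ is_zero (X 0%N), coh_iso (X n) F,
        forall j, (j < n)%N ->
          (exists (i : coh_hom (X j) (X j.+1)) (q : coh_hom (X j.+1) (Q j)),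
             short_exact i q) /\
          ~ is_zero (Q j) /\ generated (eq (E (phi j))) (Q j),
        forall i j, (i < j < n)%N -> ~~ leT (phi i) (phi j)
      & forall c, all (fun d => ~~ leT d c) s ->
          forall j, (j < n)%N -> ~~ leT (phi j) c].
Proof.
elim=> {s F} [F F0|b s F' F Q i q se Qb Q0 bs _ [n [X [R [phi [X0 XF fil ord bd]]]]]].
  exists 0%N, (fun=> F), (fun=> F), (fun=> t); split=> // [|i j].
    by apply: (@inj_surj_iso _ _ _ (id_hom F)); [exact: id_inj|exact: id_surj].
  by rewrite ltn0 andbF.
pose X' j := if (j <= n)%N then X j else F.
pose R' j := if (j < n)%N then R j else Q.
pose phi' j := if (j < n)%N then phi j else b.
exists n.+1, X', R', phi'; split.
- by rewrite /X' leq0n.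
- rewrite /X' ltnn; apply: (@inj_surj_iso _ _ _ (id_hom F)).
    exact: id_inj.
  exact: id_surj.
- move=> j; rewrite ltnS leq_eqVlt /X' /R' /phi' => /predU1P[->|jn].
    rewrite leqnn !ltnn; split=> //.
    have [f [fi fs]] := coh_iso_inj XF.
    by exists (comp_hom i f), q; apply: short_exact_comp_iso.
  by rewrite (ltnW jn) jn; exact: fil.
- move=> i' j /andP[ij]; rewrite ltnS leq_eqVlt /phi' => /predU1P[jn|jn].
    by rewrite jn ltnn -jn in ij *; rewrite ij; apply: bd; rewrite // -jn.
  by rewrite jn (ltn_trans ij jn); apply: ord; rewrite ij.
move=> c /= /andP[bc sc] j; rewrite ltnS leq_eqVlt /phi' => /predU1P[->|jn].
  by rewrite ltnn.
by rewrite jn; apply: bd.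
Qed.

Hypothesis E_nonzero : forall b, ~ is_zero (E b).

(** A new top index is either strictly below the strict filtration already obtained or equal to its
    first index. The clause on lower bounds c carries the sortedness of [s] over to [s']. *)
Lemma filtered_strictly s F : sorted leT s -> filtered s F ->
  exists2 s', strictly_filtered s' F &
    forall c, (if s is b :: _ then leT c b else true) -> all (leT c) s'.
Proof.
have [refl anti trans tot] := leT_order.
elim: s F => [|b s IH] F /= srt Fs; inversion Fs as [? F0|? ? F' ? i q se F's].
  by exists [::] => //; exact: strictly_filtered_nil.
subst; have [s' F's' les'] := IH _ (path_sorted srt) F's.
have bs' : all (leT b) s'.
  by apply: les'; case: s srt {IH F's} Fs => //= c s /andP[].
have trs c : leT c b -> all (leT c) s'.
  by move=> cb; apply: sub_all bs' => d; exact: trans.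
have gen : generated (eq (E b)) (E b) by exact: generated_in.
case: F's' bs' trs i se {IH les' Fs F's}.
  move=> F'' F''0 _ _ i se; exists [:: b] => [|c]; last by rewrite /= andbT.
  exact: (strictly_filtered_cons (s := [::]) se gen (@E_nonzero b) isT
    (strictly_filtered_nil F''0)).
move=> c s'' F'' F1 Q i1 q1 se1 Qc Q0 cs'' F''s /= /andP[bc bs''] trs i se.
have [cb|cb] := boolP (leT c b); last first.
  exists [:: b, c & s''] => [|d db /=]; last by rewrite db trs.
  apply: strictly_filtered_cons se gen (@E_nonzero b) _ _.
    rewrite /= cb; apply: sub_all cs'' => d; apply: contra => db.
    exact: trans db bc.
  exact: strictly_filtered_cons se1 Qc Q0 cs'' F''s.
have ecb : c = b by apply: anti; rewrite cb bc.
rewrite {c}ecb in bc cb Qc cs'' trs.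
(* Equal indices: F / F'' is an extension of [E b] by Q, hence generated by [E b], and it replaces
   both factors. *)
have [C [p [u [v [sep sev]]]]] := third_iso se1 se.
exists (b :: s'') => //; apply: strictly_filtered_cons sep _ _ cs'' F''s.
  exact: generated_ext sev Qc gen.
by move=> /(inj_is_zero (short_exact_inj sev)).
Qed.

Lemma filtered_last b s F : filtered (b :: s) F ->
  exists i : coh_hom (E (last b s)) F, hom_inj i.
Proof.
elim: s b F => [|c s IH] b F Fs; inversion Fs as [|? ? F' ? i q se F's]; subst.
  inversion F's as [? F'0|]; subst.
  have /coh_iso_sym/coh_iso_inj[f [fi _]] := short_exact_zero_iso se F'0.
  by exists f.
have [j ji] := IH _ _ F's.
by exists (comp_hom i j); apply: comp_inj => //; apply: short_exact_inj se.
Qed.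

Hypothesis E_vanish : forall b c, ~~ leT b c -> vanish (E b) (E c).
Hypothesis E_filtered : forall F, exists2 s, sorted leT s & filtered s F.

Lemma family_stability : is_stability_data family_slicing.
Proof.
split=> //=.
- move=> a F F0; apply: generated_summand (zero_direct_summand (E a) F0) _.
  exact: generated_in.
- by move=> a; exists (E a) => //; apply: generated_in.
- by move=> a F G FG Fa; apply: generated_iso FG Fa.
- by move=> a A B C i q se Aa Ca; apply: generated_ext se Aa Ca.
- move=> a b F G f ba Fa Gb.
  apply: (vanish_generatedr _ Gb) f => A <-.
  by apply: vanish_generatedl Fa => B <-; exact: E_vanish.
move=> F F0; have [s srt Fs] := E_filtered F.
case: s srt Fs => [_ Fs|t s srt Fs]; first by inversion Fs.
have [s' Fs' _] := filtered_strictly srt Fs.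
have [n [X [Q [phi [? ? ? ord _]]]]] := strictly_filtered_HN t Fs'.
by exists n, X, Q, phi; split.
Qed.

Variable D : slicing k.
Hypothesis Dst : is_stability_data D.
Variable r : T -> phase D.
Hypothesis r_slice : forall b, slice (r b) (E b).
Hypothesis r_mono : forall b c, leT b c -> phase_le (r b) (r c).

Fixpoint all_phase (a : phase D) (s : seq T) : Prop :=
  if s is b :: s' then r b = a /\ all_phase a s' else True.

(** Since r is monotone, the phases along the path are squeezed between a at the head and a at the
    end. *)
Lemma all_phase_path a b s : path leT b s -> phase_le a (r b) ->
  phase_le (r (last b s)) a -> all_phase a (b :: s).
Proof.
have [refl anti trans tot] := leT_order; have [reflD antiD transD _] := stab_order Dst.
elim: s b => [|c s IH] b /=; first by move=> _ ab ba; split=> //; apply: antiD; rewrite ab ba.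
move=> /andP[bc cs] ab la.
have cl : leT c (last c s).
  elim: s c cs {bc la IH} => [|d s IHs] c //= /andP[cd /IHs]; exact: trans.
split; last by apply: IH => //; apply: transD ab (r_mono bc).
apply: antiD; rewrite ab andbT; apply: transD (r_mono bc) (transD _ _ _ (r_mono cl) la).
Qed.

Lemma filtered_all_phase a s F : ~ is_zero F -> slice a F -> sorted leT s ->
  filtered s F -> s <> [::] /\ all_phase a s.
Proof.
move=> F0 Fa; case: s => [_ Fs|b s srt Fs]; first by inversion Fs.
split=> //; apply: all_phase_path => //.
  inversion Fs as [|? ? F' ? i q se _]; subst.
  apply: (hom_phase_le Dst (f := q) Fa (r_slice b)) => z.
  exact/E_nonzero/surj_zero_hom/z/short_exact_surj/se.
have [i ii] := filtered_last Fs.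
apply: (hom_phase_le Dst (f := i) (r_slice _) Fa) => z.
exact/E_nonzero/inj_zero_hom/z.
Qed.

(** Surjectivity of r comes from the slices being nonzero: the filtration of a nonzero sheaf of
    phase a has a factor, whose index r sends to a. It also accounts for the zero sheaves, as
    summands of some [E b] of phase a. *)
Lemma family_finer : finer family_slicing D.
Proof.
have surj a : exists b, r b = a.
  have [F Fa F0] := stab_nonzero Dst a; have [s srt Fs] := E_filtered F.
  have [] := filtered_all_phase F0 Fa srt Fs.
  by case: s {srt Fs} => // b s _ [<- _]; exists b.
exists r; split=> // [b c|a F].
  rewrite /phase_lt /= => bc; apply: r_mono.
  by have [_ _ _ tot] := leT_order; have := tot b c; rewrite (negPf bc) ?orbF.
split=> [Fa|]; last first.
  apply: (generated_slice Dst) => A [b <-] /=.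
  by apply: (generated_slice Dst) => B <-.
have [F0|F0] := pselect (is_zero F).
  have [b rb] := surj a.
  apply: generated_summand (zero_direct_summand (E b) F0) _.
  by apply: generated_in; exists b => //; exact: generated_in.
have [s srt Fs] := E_filtered F.
have [s0] := filtered_all_phase F0 Fa srt Fs.
elim: Fs s0 {srt Fa F0} => // b s' F' {}F i q se F's' IH _ /= [rb as'].
have Eb : generated (fun G => exists2 b, r b = a & generated (eq (E b)) G) (E b).
  by apply: generated_in; exists b => //; exact: generated_in.
apply: (generated_ext se _ Eb).
case: s' F's' as' IH => [F's' _ _|c s' _ cs IH]; last exact: IH.
inversion F's'; subst.
exact: generated_summand (zero_direct_summand (E b) _) Eb.
Qed.
End Filtrations.

(** * Morphisms to line bundles *)

Section Laurent.
Variable k : fieldType.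
Local Notation K := {fraction {poly k}}.
Local Notation x := (tofrac ('X : {poly k})).
Local Notation vL := (@laurent_val k).

Lemma x_neq0 : x != 0 :> K. Proof. by rewrite tofrac_eq0 polyX_eq0. Qed.

Lemma vLM (u v : laurent k) : vL (u * v) = vL u * vL v. Proof. by []. Qed.

Lemma laurent_xexpE n : vL (laurent_xexp k n) = x ^ n.
Proof.
have E (a : laurent k) m : vL (a ^+ m) = vL a ^+ m.
  by elim: m => [|m IH] //; rewrite !exprS -IH.
by case: n => m; rewrite /= E // exprVn.
Qed.

Lemma vL_chart1_comp (p q : {poly k}) :
  vL (chart1 (p * q)) = vL (chart1 p) * vL (chart1 q).
Proof. by rewrite rmorphM. Qed.

Lemma vL_chart1D (p q : {poly k}) :
  vL (chart1 (p + q)) = vL (chart1 p) + vL (chart1 q).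
Proof. by rewrite rmorphD. Qed.

Lemma vL_chart1C c : vL (chart1 c%:P) = tofrac (c%:P : {poly k}).
Proof. by rewrite chart1C. Qed.

Lemma vL_chart1X : vL (chart1 'X) = x^-1.
Proof. by rewrite chart1X. Qed.

Lemma vL_chart1Xn n : vL (chart1 'X^n) = x ^- n.
Proof.
elim: n => [|n IH]; first by rewrite expr0 rmorph1 expr0 invr1.
by rewrite !exprS vL_chart1_comp IH vL_chart1X invfM.
Qed.

Lemma chart1_inj : injective (@chart1 k).
Proof. by apply: raddf_inj => p; exact: chart1_eq0. Qed.

Lemma vL_inj : injective vL. Proof. exact: val_inj. Qed.

Lemma tofrac_poly_inj : injective (fun p : {poly k} => tofrac p).
Proof. by move=> p q /eqP; rewrite tofrac_eq => /eqP. Qed.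

(** Multiplying q(1/x) by x^m reverses the coefficients of q. The degree bound m is what contradicts
    a pole order in [line_sections_neg]. *)
Lemma chart1_mulXn (q : {poly k}) :
  exists m (p : {poly k}), (size p <= m.+1)%N /\ vL (chart1 q) * x ^+ m = tofrac p.
Proof.
elim/poly_ind: q => [|q c [m [p [sp e]]]].
  by exists 0%N, 0; rewrite size_poly0 !rmorph0 mul0r.
exists m.+1, (p + c%:P * 'X^(m.+1)); split.
  apply: leq_trans (size_polyD _ _) _; rewrite geq_max (leq_trans sp) //=.
  by rewrite mul_polyC (leq_trans (size_scale_leq _ _)) // size_polyXn.
rewrite vL_chart1D vL_chart1_comp vL_chart1X vL_chart1C mulrDl !rmorphD !rmorphM.
rewrite rmorphXn /= -e; congr (_ + _).
by rewrite exprS -!mulrA [x^-1 * _]mulrA mulVf ?mul1r // x_neq0.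
Qed.

(* H^0 (O (- m - 1)) = 0 *)
Lemma line_sections_neg (p q : {poly k}) m :
  tofrac p = vL (chart1 q) * x ^- m.+1 -> p = 0.
Proof.
move=> e; have [j [p' [sp' e']]] := chart1_mulXn q.
have : p * 'X^(m.+1 + j) = p'.
  apply: tofrac_poly_inj; rewrite rmorphM rmorphXn /= -e' e exprD mulrA.
  by rewrite -[_ / _ * _]mulrA mulVf ?mulr1 // expf_neq0 // x_neq0.
apply: contra_eq => p0; apply: contraTneq sp' => <-.
rewrite -ltnNge size_Mmonic ?monicXn // size_polyXn; have : (0 < size p)%N by rewrite size_poly_gt0.
lia.
Qed.

(* H^1 (O (- 1)) = 0 *)
Lemma laurent_decomp (l : laurent k) :
  exists p q : {poly k}, vL l = tofrac p + x^-1 * vL (chart1 q).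
Proof.
have [[p m] /= /eqP e] := laurent_repr l.
have -> : vL l = tofrac p * x ^- m.
  by rewrite -e rmorphXn /= mulfK // expf_neq0 // x_neq0.
elim: m p {e} => [|m IH] p.
  by exists p, 0; rewrite !rmorph0 mulr0 addr0 expr0 invr1 mulr1.
(* In (p X + c) / x^(m+1) the first term has a smaller pole, and the second is x^-1 times c y^m with
   y = 1/x. *)
elim/poly_ind: p => [|p c _].
  by exists 0, 0; rewrite !rmorph0 mulr0 addr0 mul0r.
have [p1 [q1 e1]] := IH p.
exists p1, (q1 + c%:P * 'X^m).
rewrite vL_chart1D vL_chart1_comp vL_chart1C vL_chart1Xn mulrDr addrA -e1.
rewrite rmorphD rmorphM /= mulrDl; congr (_ + _).
  by rewrite exprS invfM -mulrA [x * _]mulrA divff ?mul1r // x_neq0.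
by rewrite exprS invfM mulrCA.
Qed.

Implicit Types F G : coh k.

(* A morphism F -> O(n) amounts to a Laurent-linear map F(U01) -> k(x) sending
   F(U0) to k[x] and F(U1) to x^n k[x^-1]. *)
Record lmap (n : int) F (f : sec01 F -> K) : Prop := Lmap {
  lmap_linear : forall (l : laurent k) u v, f (l *: u + v) = vL l * f u + f v;
  lmap_res0 : forall m, exists p : {poly k}, f (res0 F m) = tofrac p;
  lmap_res1 : forall m, exists q : {poly k},
    f (res1 F m) = vL (chart1 q) * x ^ n }.

(** This is Hom(F, O(n)) <> 0, by [has_lmap_vanish]. As the target k(x) is the same for all n, one f
    can serve for several n. *)
Definition has_lmap (n : int) F : Prop :=
  exists2 f : sec01 F -> K, lmap n f & exists s, f s != 0.

Section LmapTheory.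
Variables (n : int) (F : coh k) (f : sec01 F -> K).
Hypothesis fl : lmap n f.

Lemma lmapD u v : f (u + v) = f u + f v.
Proof. by rewrite -[u]scale1r (lmap_linear fl) mul1r scale1r. Qed.

Lemma lmap0 : f 0 = 0.
Proof. by apply: (addrI (f 0)); rewrite -lmapD !addr0. Qed.

Lemma lmapZ l u : f (l *: u) = vL l * f u.
Proof. by rewrite -[l *: u]addr0 (lmap_linear fl) lmap0 addr0. Qed.

Lemma lmap_sum (I : Type) (r : seq I) (P : pred I) (G : I -> sec01 F) :
  f (\sum_(i <- r | P i) G i) = \sum_(i <- r | P i) f (G i).
Proof. exact: (big_morph f lmapD lmap0). Qed.

Lemma lmap_eq0 : (forall m, f (res0 F m) = 0) -> forall s, f s = 0.
Proof.
by move=> f0 s; have [j [m ->]] := sec01_repr0 s; rewrite lmapZ f0 mulr0.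
Qed.

Lemma lmap_neq0 s : f s != 0 -> exists m, f (res0 F m) != 0.
Proof.
move=> fs; apply: contrapT => nex; case/eqP: fs; apply: lmap_eq0 => m.
by apply/eqP; apply: contrapT => /negP fm; apply: nex; exists m.
Qed.

Lemma lmap_laurent s : exists l, f s = vL l.
Proof.
have [j [m ->]] := sec01_repr0 s; have [p e] := lmap_res0 fl m.
by exists (laurent_xV k ^+ j * chart0 p); rewrite lmapZ e.
Qed.
End LmapTheory.

Lemma lmap_hom n F (f : sec01 F -> K) : lmap n f ->
  exists g : coh_hom F (line_bundle k n), forall s, vL (hom01 g s) = f s.
Proof.
move=> fl; have [f01 e01] := choice (lmap_laurent fl).
have [f0 e0] := choice (lmap_res0 fl); have [f1 e1] := choice (lmap_res1 fl).
have lin01 : linear (f01 : sec01 F -> (laurent k)^o).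
  move=> l u v; apply: vL_inj.
  by rewrite -e01 (lmap_linear fl) !e01.
have lin0 : linear (f0 : sec0 F -> {poly k}^o).
  move=> l u v; apply: tofrac_poly_inj.
  by rewrite -e0 linearP (lmap_linear fl) !e0 /= rmorphD rmorphM.
have lin1 : linear (f1 : sec1 F -> {poly k}^o).
  move=> l u v; apply/chart1_inj/vL_inj/(mulIf (expfz_neq0 n x_neq0)).
  rewrite -e1 linearP (lmap_linear fl) !e1 /= vL_chart1D vL_chart1_comp.
  by rewrite mulrDl mulrA.
unshelve eexists (@CohHom k F (line_bundle k n) (mk_linear lin0) (mk_linear lin1)
  (mk_linear lin01) _ _) => [m|m|s].
- by apply: vL_inj; rewrite /= -e01 e0.
- by apply: vL_inj; rewrite /= -e01 e1 laurent_xexpE.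
- by rewrite /= e01.
Qed.

Lemma hom_lmap n F (g : coh_hom F (line_bundle k n)) :
  lmap n (fun s => vL (hom01 g s)).
Proof.
split=> [l u v|m|m]; first by rewrite linearP.
- by exists (hom0 g m); rewrite hom_res0.
- by exists (hom1 g m); rewrite hom_res1 /= laurent_xexpE.
Qed.

Lemma line_hom_zero n F (g : coh_hom F (line_bundle k n)) :
  (forall s, vL (hom01 g s) = 0) -> hom_is_zero g.
Proof.
move=> z; have z01 s : hom01 g s = 0 by apply: vL_inj; rewrite z.
apply: hom_is_zero01 => m.
- apply: chart0_inj; rewrite rmorph0 -[RHS](z01 (res0 F m)) hom_res0 //.
- apply: chart1_inj; apply: vL_inj; apply: (mulIf (expfz_neq0 n x_neq0)).
  by rewrite rmorph0 mul0r -[RHS](z (res1 F m)) hom_res1 /= laurent_xexpE.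
Qed.

Lemma has_lmap_vanish n F : ~ has_lmap n F <-> vanish F (line_bundle k n).
Proof.
split=> [nl g|v [f fl [s /eqP fs]]].
  apply: line_hom_zero => s; apply: contrapT => /eqP gs; apply: nl.
  by exists (fun s => vL (hom01 g s)); [exact: hom_lmap|exists s].
by have [g eg] := lmap_hom fl; have [_ _ z] := v g; apply: fs; rewrite -eg z.
Qed.

Lemma lmap_le m n F (f : sec01 F -> K) : m <= n -> lmap m f -> lmap n f.
Proof.
move=> mn [lin f0 f1]; split=> // s; have [q ->] := f1 s.
have [j jE] : exists j : nat, n = m + j by exists `|n - m|%N; lia.
exists (q * 'X^j); rewrite vL_chart1_comp vL_chart1Xn jE expfzDr ?x_neq0 //.
by rewrite -mulrA [x ^- j * _]mulrCA mulVf ?mulr1 // expf_neq0 // x_neq0.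
Qed.

(** The map is determined by f(1), a polynomial in x by the chart U0, while the generator x^m over
    U1 forces f(1) into x^(n-m) k[1/x], with n - m negative. *)
Lemma line_vanish m n : m > n -> vanish (line_bundle k m) (line_bundle k n).
Proof.
move=> nm; apply/has_lmap_vanish => -[f fl [s]].
have [j jE] : exists j : nat, m = n + j.+1 by exists `|m - n|%N.-1; lia.
have f1 : f (1 : (laurent k)^o) = 0.
  have [p e0] := lmap_res0 fl (1 : {poly k}^o); have [q e1] := lmap_res1 fl (1 : {poly k}^o).
  have e0' : f (1 : (laurent k)^o) = tofrac p.
    by rewrite -e0 /= /line_res0 rmorph1.
  rewrite e0' (_ : p = 0) ?rmorph0 //; apply: (@line_sections_neg p q j).
  apply: (mulIf (expfz_neq0 m x_neq0)); rewrite -mulrA jE expfzDr ?x_neq0 //.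
  rewrite [x ^- _ * _]mulrCA mulVf ?expf_neq0 ?x_neq0 // mulr1 -e1 /= /line_res1.
  rewrite rmorph1 mul1r -expfzDr ?x_neq0 // -jE -[laurent_xexp k m]mulr1.
  by rewrite [f _](lmapZ fl) laurent_xexpE e0' mulrC.
have -> : s = (s : laurent k) *: (1 : (laurent k)^o) by rewrite [RHS]mulr1.
by rewrite (lmapZ fl) f1 mulr0 eqxx.
Qed.

Lemma line_has_lmap m n : m <= n -> has_lmap n (line_bundle k m).
Proof.
move=> mn; exists (vL : (laurent k)^o -> K); last by exists 1; exact: oner_neq0.
apply: lmap_le mn _; split=> // u; first by exists u.
by exists u; rewrite /= laurent_xexpE.
Qed.

Lemma line_nonzero n : ~ is_zero (line_bundle k n).
Proof. by case=> /(_ 1)/eqP; rewrite oner_eq0. Qed.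

(** Each generator of F(U0) is x^e times a section from U1, so f sends it to a polynomial lying in
    x^(n+e) k[1/x]. This is 0 once n + e < 0, and N is the largest e. *)
Lemma lmap_bounded F : exists N : nat, forall n, has_lmap n F -> - N%:Z <= n.
Proof.
have [r [g gen]] := coh_fg0 F.
have [e eE] := choice (fun i => sec01_repr1 (res0 F (g i))).
exists (\max_(i < r) e i) => n [f fl [s]].
apply: contraR; rewrite -ltNge => nN; apply/eqP; apply: (lmap_eq0 fl) => m {s}.
have [c ->] := gen m; rewrite linear_sum (lmap_sum fl) big1 // => i _.
rewrite res0Z (lmapZ fl); have [p pE] := lmap_res0 fl (g i).
rewrite pE (_ : p = 0) ?rmorph0 ?mulr0 //.
have [w wE] := eE i; have [q qE] := lmap_res1 fl w.
have le_i : (e i <= \max_(i < r) e i)%N by exact: leq_bigmax.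
have [j jE] : exists j : nat, n + (e i)%:Z = - (j.+1)%:Z.
  by exists (absz (n + Posz (e i))%R).-1; lia.
apply: (@line_sections_neg p q j); rewrite -pE wE (lmapZ fl) qE mulrCA.
have -> : vL (chart0 'X ^+ e i) = x ^ (e i).
  by rewrite -laurent_xexpE.
by rewrite -expfzDr ?x_neq0 // addrC jE.
Qed.

Lemma lmap_min n F : has_lmap n F -> exists m, has_lmap m F /\ ~ has_lmap (m - 1) F.
Proof.
move=> h; have [N bd] := lmap_bounded F.
have nN := bd _ h; have [j jE] : exists j : nat, n = - N%:Z + j.
  by exists (absz (n + Posz N)%R); lia.
elim: j n jE h {nN} => [|j IH] n jE h.
  exists n; split=> // /bd; lia.
have [h'|h'] := pselect (has_lmap (n - 1) F); last by exists n.
by apply: IH h'; lia.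
Qed.
End Laurent.

(** The Nullstellensatz on the line: a nonzero element of least degree divides the whole ideal, so a
    root of it would be a common root. *)
Lemma ideal_unit (k : closedFieldType) (I : {poly k} -> Prop) :
  (forall a p q, I p -> I q -> I (a * p + q)) ->
  (forall a, exists2 p, I p & p.[a] != 0) -> I 1.
Proof.
move=> Iid nroot.
have [p0 Ip0 p0a] := nroot 0.
have p0nz : p0 != 0 by apply: contraNneq p0a => ->; rewrite horner0.
have I0 : I 0 by have := Iid (-1) p0 p0 Ip0 Ip0; rewrite mulN1r addNr.
pose P n := `[< exists p, [/\ I p, p != 0 & size p = n] >].
have exP : exists n, P n by exists (size p0); apply/asboolP; exists p0.
case: (ex_minnP exP) => n /asboolP[p [Ip pnz sp]] nmin.
have dvd q : I q -> p %| q.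
  move=> Iq; apply: contraT; rewrite /dvdp => r0.
  have : P (size (q %% p)).
    apply/asboolP; exists (q %% p); split=> //.
    have -> : q %% p = - (q %/ p) * p + q
      by apply: (addrI (q %/ p * p)); rewrite -divp_eq mulNr addrA subrr add0r.
    exact: Iid.
  by move/nmin; rewrite -sp leqNgt ltn_modp pnz.
have [sp1|sp1] := boolP (size p == 1%N).
  have /size_poly1P[c c0 pc] := sp1.
  have := Iid (c^-1)%:P p 0 Ip I0.
  by rewrite pc -polyCM mulVf // addr0.
have /closed_rootP[a pa] := sp1; have [q /dvd pq] := nroot a.
by rewrite -rootE -dvdp_XsubCl (dvdp_trans _ pq) // dvdp_XsubCl.
Qed.

(** * Surjectivity onto the minimal line bundle, and extension of maps from its kernel *)

Section LineQuotient.
Variable k : closedFieldType.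
Local Notation K := {fraction {poly k}}.
Local Notation x := (tofrac ('X : {poly k})).
Local Notation vL := (@laurent_val k).
Implicit Types F G : coh k.

Lemma laurent_eval_xV (a : k) (a0 : a != 0) : laurent_eval a0 (laurent_xV k) = a^-1.
Proof. by rewrite -chart1X laurent_eval_chart1 hornerX. Qed.

Lemma laurent_evalM (a : k) (a0 : a != 0) u v :
  laurent_eval a0 (u * v) = laurent_eval a0 u * laurent_eval a0 v.
Proof. exact: rmorphM. Qed.

Lemma laurent_eval_xexp (a : k) (a0 : a != 0) n :
  laurent_eval a0 (laurent_xexp k n) != 0.
Proof.
case: n => m /=; rewrite ?laurent_eval_xV rmorphXn /= expf_neq0 //.
  by rewrite laurent_eval_chart0 hornerX.
by rewrite laurent_eval_xV invr_eq0.
Qed.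

Section Minimal.
Variables (n : int) (F : coh k) (f : sec01 F -> K).
Hypothesis fl : lmap n f.
Hypothesis f_nonzero : exists s, f s != 0.
Hypothesis nmin : ~ has_lmap (n - 1) F.

(** If all values over U0 vanished at a, then f / (x - a) would be a nonzero map to O(n - 1),
    against minimality; w is 1 / (x - a). *)
Lemma lmap_nonroot0 (a : k) : exists p m, f (res0 F m) = tofrac p /\ p.[a] != 0.
Proof.
apply: contrapT => nex; apply: nmin.
have root0 m p : f (res0 F m) = tofrac p -> p.[a] = 0.
  by move=> e; apply/eqP; apply: contrapT => /negP pa; apply: nex; exists p, m.
have [d [w [dE wd]]] : exists d w, d = tofrac ('X - a%:P : {poly k}) /\ d * w = 1.
  exists (tofrac ('X - a%:P)), (tofrac ('X - a%:P))^-1; split=> //.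
  by rewrite mulfV // tofrac_eq0 polyXsubC_eq0.
exists (fun s => f s * w); last first.
  have [s fs] := f_nonzero; exists s; apply: contraNneq fs => fw.
  by rewrite -[f s]mulr1 -wd mulrCA fw mulr0.
split=> [l u v|m|m].
- by rewrite (lmap_linear fl) mulrDl -mulrA.
- have [p e] := lmap_res0 fl m; have /eqP/factor_theorem[q pq] := root0 _ _ e.
  by exists q; rewrite e pq rmorphM /= -dE -mulrA wd mulr1.
have [q e] := lmap_res1 fl m.
(* With y = 1/x, x - a = x (1 - a y): over U1 the division lowers the exponent n by one and needs 1
   - a y to divide q. *)
suff [q' qE] : exists q', q = q' * (1 - a%:P * 'X).
  exists q'; rewrite e qE vL_chart1_comp.
  have -> : vL (chart1 (1 - a%:P * 'X)) = d * x^-1.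
    have -> : 1 - a%:P * 'X = 1%:P + (- a)%:P * 'X :> {poly k} by rewrite polyCN mulNr.
    rewrite vL_chart1D vL_chart1_comp !vL_chart1C vL_chart1X polyCN rmorphN dE.
    by rewrite rmorphB /= mulrBl mulfV ?x_neq0 // mulNr rmorph1.
  rewrite expfzDr ?x_neq0 // exprN1; move: (x ^ n) (x^-1) => y z.
  by rewrite -!mulrA; congr (_ * _); rewrite mulrC -!mulrA [w * d]mulrC wd mulr1 mulrC.
have [a0|a0] := eqVneq a 0.
  by exists q; rewrite a0 mul0r subr0 mulr1.
(* For a <> 0 the point lies on both charts. As x^j m extends to U0, its value under f vanishes at
   a, so q(1/a) = 0; and y - 1/a is 1 - a y up to a constant. *)
have [j [m' e']] := (coh_loc0 F).2 (res1 F m).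
have [p pE] := lmap_res0 fl m'.
have : laurent_eval a0 (chart0 ('X ^+ j) * (chart1 q * laurent_xexp k n))
  = laurent_eval a0 (chart0 p).
  congr (laurent_eval a0 _); apply: vL_inj.
  by rewrite -[RHS]pE -e' (lmapZ fl) e /= laurent_xexpE.
rewrite !laurent_evalM !laurent_eval_chart0 laurent_eval_chart1 (root0 _ _ pE).
move/eqP; rewrite 2!mulf_eq0 hornerXn expf_eq0 (negPf a0) andbF orFb.
rewrite (negPf (laurent_eval_xexp _ _)) orbF => /factor_theorem[q' ->].
exists (q' * (- a^-1)%:P); rewrite -mulrA; congr (_ * _).
by rewrite mulrBr mulr1 mulrA -polyCM mulNr mulVf // !polyCN; ring.
Qed.

(** At y = 0, a common zero would make f itself a map to O(n - 1), since y x^n = x^(n-1). Any other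
    point lies on U0, where [lmap_nonroot0] applies. *)
Lemma lmap_nonroot1 (b : k) :
  exists q m, f (res1 F m) = vL (chart1 q) * x ^ n /\ q.[b] != 0.
Proof.
apply: contrapT => nex.
have root1 m q : f (res1 F m) = vL (chart1 q) * x ^ n -> q.[b] = 0.
  by move=> e; apply/eqP; apply: contrapT => /negP pa; apply: nex; exists q, m.
have [b0|b0] := eqVneq b 0.
  apply: nmin; exists f => //; split; [exact: lmap_linear fl|exact: lmap_res0 fl|move=> m].
  have [q e] := lmap_res1 fl m; have /eqP/factor_theorem[q' qE] := root1 _ _ e.
  exists q'; rewrite e qE b0 polyC0 subr0 vL_chart1_comp vL_chart1X.
  by rewrite expfzDr ?x_neq0 // exprN1 -mulrA; congr (_ * _); rewrite mulrC.
have a0 : b^-1 != 0 by rewrite invr_eq0.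
have [p [m [pE /eqP]]] := lmap_nonroot0 b^-1; apply.
have [j [m' e']] := (coh_loc1 F).2 (res0 F m).
have [q qE] := lmap_res1 fl m'.
have : laurent_eval a0 (chart1 ('X ^+ j) * chart0 p)
  = laurent_eval a0 (chart1 q * laurent_xexp k n).
  congr (laurent_eval a0 _); apply: vL_inj.
  by rewrite [RHS]/= laurent_xexpE -qE -e' (lmapZ fl) pE.
rewrite !laurent_evalM !laurent_eval_chart0 !laurent_eval_chart1 invrK (root1 _ _ qE).
by rewrite mul0r hornerXn => /eqP; rewrite mulf_eq0 expf_eq0 (negPf b0) andbF => /eqP.
Qed.

Lemma lmap_min_surj0 : exists m, f (res0 F m) = 1.
Proof.
suff: exists m, f (res0 F m) = tofrac (1 : {poly k}).
  by case=> m; rewrite rmorph1 => e; exists m.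
apply: (@ideal_unit k (fun p => exists m, f (res0 F m) = tofrac p)).
  move=> a p q [m e] [m' e']; exists (a *: m + m').
  by rewrite linearP (lmap_linear fl) e e' rmorphD rmorphM.
by move=> a; have [p [m [e pa]]] := lmap_nonroot0 a; exists p => //; exists m.
Qed.

Lemma lmap_min_surj1 : exists m, f (res1 F m) = x ^ n.
Proof.
suff: exists m, f (res1 F m) = vL (chart1 (1 : {poly k})) * x ^ n.
  by case=> m; rewrite rmorph1 mul1r => e; exists m.
apply: (@ideal_unit k (fun q => exists m, f (res1 F m) = vL (chart1 q) * x ^ n)).
  move=> a p q [m e] [m' e']; exists (a *: m + m').
  by rewrite linearP (lmap_linear fl) e e' vL_chart1D vL_chart1_comp mulrDl mulrA.
by move=> a; have [p [m [e pa]]] := lmap_nonroot1 a; exists p => //; exists m.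
Qed.
End Minimal.

(** Surjectivity is recorded as preimages of the two local generators, because they split q over
    each chart. *)
Lemma min_line_quotient n F : has_lmap n F -> ~ has_lmap (n - 1) F ->
  exists q : coh_hom F (line_bundle k n),
    (exists e0, hom0 q e0 = 1) /\ (exists e1, hom1 q e1 = 1).
Proof.
move=> [f fl fs] nmin; have [q qE] := lmap_hom fl; exists q.
have [e0 e0E] := lmap_min_surj0 fl fs nmin.
have [e1 e1E] := lmap_min_surj1 fl fs nmin.
split; [exists e0|exists e1].
  by apply: tofrac_poly_inj; rewrite rmorph1 -e0E -qE hom_res0.
apply: chart1_inj; apply: vL_inj; apply: (mulIf (expfz_neq0 n (x_neq0 k))).
by rewrite rmorph1 mul1r -[RHS]e1E -qE hom_res1 /= laurent_xexpE.
Qed.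

Section Extension.
Variables (n : int) (F F' : coh k) (i : coh_hom F' F).
Variable q : coh_hom F (line_bundle k n).
Hypothesis se : short_exact i q.
Variables (e0 : sec0 F) (e1 : sec1 F).
Hypotheses (qe0 : hom0 q e0 = 1) (qe1 : hom1 q e1 = 1).

(** Over U01, F is F' plus the line spanned by e0, with projection [pr] and coordinate [c]. An
    extension is fixed by its value -p at e0, where p must be a polynomial such that the value at e1
    lies in x^(n-1) k[1/x]. *)
Lemma lmap_extend (f' : sec01 F' -> K) : lmap (n - 1) f' ->
  exists2 f : sec01 F -> K, lmap (n - 1) f & forall s, f (hom01 i s) = f' s.
Proof.
move=> fl'; have [[i0 s0 x0] [i1 s1 x1] [i01 s01 x01]] := se.
have q01e0 : hom01 q (res0 F e0) = 1.
  by rewrite hom_res0 qe0 /= /line_res0 rmorph1.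
have q01e1 : hom01 q (res1 F e1) = laurent_xexp k n.
  by rewrite hom_res1 qe1 /= /line_res1 rmorph1 mul1r.
pose c s : laurent k := hom01 q s.
have /choice[pr prE] s : exists t, hom01 i t = s - c s *: res0 F e0.
  apply/x01; rewrite linearB linearZ /= q01e0.
  by rewrite [X in _ - X]mulr1 subrr.
have cP l u v : c (l *: u + v) = l * c u + c v by rewrite /c linearP.
have prP l u v : pr (l *: u + v) = l *: pr u + pr v.
  apply: i01; rewrite linearP !prE cP scalerDl -scalerA scalerBr.
  by rewrite opprD addrACA.
have ci t : c (hom01 i t) = 0 by apply/x01; exists t.
have pri t : pr (hom01 i t) = t by apply: i01; rewrite prE ci scale0r subr0.
have pre0 : pr (res0 F e0) = 0.
  by apply: i01; rewrite prE /c q01e0 scale1r subrr linear0.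
have [l lE] := lmap_laurent fl' (pr (res1 F e1)).
(* The value at e1 is l - p x^n. Splitting l x^-n as p + x^-1 r(1/x) makes it x^(n-1) r(1/x), as
   wanted; this is where H^1(O(-1)) = 0 enters. *)
have [p [r e]] := laurent_decomp (l * laurent_xexp k (- n)).
pose f s := f' (pr s) - vL (c s) * tofrac p.
have fP l' u v : f (l' *: u + v) = vL l' * f u + f v.
  by rewrite /f prP cP (lmap_linear fl') /=; ring.
have fi t : f (hom01 i t) = f' t by rewrite /f pri ci mul0r subr0.
exists f => //; split=> // m.
  have [m' m'E] : exists m', hom0 i m' = m - hom0 q m *: e0.
    by apply/x0; rewrite linearB linearZ /= qe0 [X in _ - X]mulr1 subrr.
  have [p' p'E] := lmap_res0 fl' m'.
  exists ((hom0 q m : {poly k}) * (- p) + p').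
  have -> : m = hom0 q m *: e0 + hom0 i m' by rewrite m'E addrC subrK.
  rewrite linearP /= -hom_res0 fP fi p'E /f pre0 /c q01e0 (lmap0 fl').
  rewrite linearP /= qe0 (_ : hom0 q (hom0 i m') = 0); last by apply/x0; exists m'.
  rewrite [hom0 q m *: _]mulr1 addr0 rmorphD rmorphM rmorphN /=.
  by rewrite mul1r sub0r.
have fe1 : f (res1 F e1) = vL (chart1 r) * x ^ (n - 1).
  have lE' : vL l = (tofrac p + x^-1 * vL (chart1 r)) * x ^ n.
    by rewrite -e vLM laurent_xexpE -mulrA -expfzDr ?x_neq0 // addNr mulr1.
  rewrite /f lE lE' /c q01e1 laurent_xexpE expfzDr ?x_neq0 // exprN1; ring.
have [m' m'E] : exists m', hom1 i m' = m - hom1 q m *: e1.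
  by apply/x1; rewrite linearB linearZ /= qe1 [X in _ - X]mulr1 subrr.
have [q' q'E] := lmap_res1 fl' m'.
exists ((hom1 q m : {poly k}) * r + q').
have -> : f (res1 F m) = f (res1 F (hom1 q m *: e1 + hom1 i m')).
  by rewrite m'E addrC subrK.
rewrite linearP /= -hom_res1 fP fi q'E fe1 vL_chart1D vL_chart1_comp.
by rewrite mulrDl mulrA.
Qed.
End Extension.

Lemma line_kernel_has_lmap n F F' (i : coh_hom F' F)
    (q : coh_hom F (line_bundle k n)) m :
  short_exact i q -> m < n -> has_lmap m F' -> has_lmap (n - 1) F.
Proof.
move=> se mn [f' fl' [s fs]].
have [[_ s0 _] [_ s1 _] _] := se.
have [e0 qe0] := s0 1; have [e1 qe1] := s1 1.
have mn1 : m <= n - 1 by lia.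
have [f fl fE] := lmap_extend se qe0 qe1 (lmap_le mn1 fl').
by exists f => //; exists (hom01 i s); rewrite fE.
Qed.
End LineQuotient.

(** * Modules over k[x] *)

Section Torsion.
Variables (R : idomainType) (M : lmodType R) (N : nat) (g : 'I_N -> M).
Hypothesis gen : forall m, exists c : 'I_N -> R, m = \sum_(i < N) c i *: g i.

Definition independent (A : {set 'I_N}) : bool :=
  `[< forall c : 'I_N -> R, \sum_(i in A) c i *: g i = 0 ->
        forall i, i \in A -> c i = 0 >].

(** By maximality of A, some nonzero multiple d_j of each generator lies in the span of A; the
    product of the d_j works for all of M. *)
Lemma max_independent : exists A d, [/\ independent A, d != 0 &
  forall m, exists c : 'I_N -> R, d *: m = \sum_(i in A) c i *: g i].
Proof.
have ind0 : independent set0 by apply/asboolP => c _ i; rewrite inE.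
have [A /maxsetP[indA maxA] _] := maxset_exists ind0.
have indP c : \sum_(i in A) c i *: g i = 0 -> forall i, i \in A -> c i = 0.
  by move: indA => /asboolP; exact.
have dep j : exists d, d != 0 /\ exists c : 'I_N -> R,
    d *: g j = \sum_(i in A) c i *: g i.
  have [jA|jA] := boolP (j \in A).
    exists 1; split; first exact: oner_neq0.
    exists (fun i => (i == j)%:R); rewrite (bigD1 j) //= eqxx big1 ?addr0 // => i.
    by case/andP => _ /negPf ->; rewrite scale0r.
  apply: contrapT => nd.
  suff indj : independent (j |: A).
    by move: jA; rewrite -(maxA _ indj) ?subsetUr // setU11.
  apply/asboolP => c; rewrite big_setU1 //= => e.
  have cj : c j = 0.
    apply/eqP; apply: contrapT => /negP cj; apply: nd; exists (c j); split=> //.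
    exists (fun i => - c i); apply/eqP; rewrite -subr_eq0 -sumrN -[X in _ == X]e.
    by apply/eqP; congr (_ + _); apply: eq_bigr => i _; rewrite scaleNr opprK.
  move: e; rewrite cj scale0r add0r => /indP cA i.
  by case/setU1P => [->|/cA].
have /choice[d dP] := dep; exists A, (\prod_j d j); split=> //.
  by apply/prodf_neq0 => j _; have [] := dP j.
have cg j : exists c : 'I_N -> R,
    (\prod_l d l) *: g j = \sum_(i in A) c i *: g i.
  have [_ [c e]] := dP j.
  exists (fun i => (\prod_(l | l != j) d l) * c i).
  rewrite (bigD1 j) //= mulrC -scalerA e scaler_sumr.
  by apply: eq_bigr => i _; rewrite scalerA.
have /choice[c cE] := cg.
move=> m; have [a ->] := gen m; exists (fun i => \sum_j a j * c j i).
rewrite scaler_sumr; under [RHS]eq_bigr do rewrite scaler_suml.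
rewrite exchange_big /=; apply: eq_bigr => j _.
rewrite scalerA mulrC -scalerA cE scaler_sumr.
by apply: eq_bigr => i _; rewrite scalerA.
Qed.

(** If A is empty, d kills M. Otherwise the i0-th coordinate of d m is unique by independence, hence
    linear in m, and it is d at [g i0]. *)
Lemma torsion_or_functional :
  (exists2 d : R, d != 0 & forall m : M, d *: m = 0) \/
  (exists (f : {linear M -> R^o}) m, f m != 0).
Proof.
have [A [d [/asboolP ind d0 cex]]] := max_independent.
have [A0|[i0 iA]] := set_0Vmem A.
  by left; exists d => // m; have [c ->] := cex m; rewrite A0 big_set0.
right; have /choice[c cE] := cex.
have lin : linear ((fun m => c m i0) : M -> R^o).
  move=> a u v; apply/eqP; rewrite -subr_eq0.
  pose e i := c (a *: u + v) i - (a * c u i + c v i).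
  rewrite -[X in X == _]/(e i0) (ind e) //.
  under eq_bigr do rewrite /e scalerBl scalerDl -scalerA.
  by rewrite sumrB big_split /= -scaler_sumr -!cE scalerDr !scalerA mulrC subrr.
exists (mk_linear lin), (g i0) => /=.
suff -> : c (g i0) i0 = d by [].
pose e i := c (g i0) i - d * (i == i0)%:R.
apply/eqP; rewrite -subr_eq0 -[d]mulr1 -[1](_ : (i0 == i0)%:R = 1); last by rewrite eqxx.
rewrite -[X in X == _]/(e i0) (ind e) //.
under eq_bigr do rewrite /e scalerBl -scalerA.
rewrite sumrB -cE (bigD1 i0) //= eqxx scale1r big1 ?addr0 ?subrr // => i.
by case/andP => _ /negPf ->; rewrite scale0r scaler0.
Qed.
End Torsion.

Section PolyModules.
Variable k : fieldType.
Implicit Type M : lmodType {poly k}.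

(** These are the functionals on the fibre M / (x - a) M. *)
Definition point_linear (a : k) M (l : M -> k) : Prop :=
  forall p u v, l (p *: u + v) = p.[a] * l u + l v.

Definition const_linear M (l : M -> k) : Prop :=
  forall (c : k) u v, l (c%:P *: u + v) = c * l u + l v.

Lemma point_const_linear a M (l : M -> k) : point_linear a l -> const_linear l.
Proof. by move=> lP c u v; rewrite lP hornerC. Qed.

Section ConstLinear.
Variables (M : lmodType {poly k}) (l : M -> k).
Hypothesis lP : const_linear l.

Lemma const_linearD u v : l (u + v) = l u + l v.
Proof. by rewrite -[u]scale1r -polyC1 lP mul1r polyC1 scale1r. Qed.

Lemma const_linear0 : l 0 = 0.
Proof. by apply: (addrI (l 0)); rewrite -const_linearD !addr0. Qed.

Lemma const_linearZ c u : l (c%:P *: u) = c * l u.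
Proof. by rewrite -[_ *: u]addr0 lP const_linear0 addr0. Qed.

Lemma const_linearB u v : l (u - v) = l u - l v.
Proof.
by rewrite const_linearD -scaleN1r -polyCN const_linearZ mulN1r.
Qed.

Lemma const_linear_sum (I : Type) (r : seq I) (P : pred I) (G : I -> M) :
  l (\sum_(i <- r | P i) G i) = \sum_(i <- r | P i) l (G i).
Proof. exact: (big_morph l const_linearD const_linear0). Qed.
End ConstLinear.

Lemma point_linearZ a M (l : M -> k) : point_linear a l ->
  forall p u, l (p *: u) = p.[a] * l u.
Proof.
move=> lP p u; rewrite -[_ *: u]addr0 lP.
by rewrite (const_linear0 (point_const_linear lP)) addr0.
Qed.

(* For Z = 0 this bounds the length of a torsion module, and for Z = X M the
   dimension of the fibre of M at 0. *)
Definition kspan (n : nat) M (Z : M -> Prop) : Prop :=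
  exists g : 'I_n -> M, forall m, exists c : 'I_n -> k,
    Z (m - \sum_(i < n) (c i)%:P *: g i).

Lemma kspan_fin (I : finType) M (Z : M -> Prop) (g : I -> M) :
  (forall m, exists c : I -> k, Z (m - \sum_i (c i)%:P *: g i)) ->
  kspan #|I| Z.
Proof.
move=> h; exists (g \o enum_val) => m; have [c cZ] := h m.
exists (c \o enum_val); move: cZ.
by rewrite (reindex _ (onW_bij _ (enum_val_bij I))).
Qed.

(** One step of Gaussian elimination: a generator with l <> 0 is subtracted from the others, with
    coefficients b, to bring them into the kernel of l, and is then dropped. For m in this kernel,
    its coefficient is determined by the others since l vanishes on Z. *)
Lemma kspan_drop n M (Z : M -> Prop) (l : M -> k) :
  kspan n Z -> const_linear l -> (forall m, Z m -> l m = 0) ->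
  (exists m, l m != 0) ->
  exists n', n = n'.+1 /\ exists g : 'I_n' -> M,
    (forall i, l (g i) = 0) /\
    forall m, l m = 0 -> exists c : 'I_n' -> k,
      Z (m - \sum_(i < n') (c i)%:P *: g i).
Proof.
move=> [g gen] lP lZ [m0 lm0].
have [i0 li0] : exists i0, l (g i0) != 0.
  apply: contrapT => nex; case/eqP: lm0; have [c /lZ] := gen m0.
  rewrite (const_linearB lP) (const_linear_sum lP) big1 ?subr0 // => i _.
  rewrite (const_linearZ lP); apply/eqP; rewrite mulf_eq0; apply/orP; right.
  by apply: contrapT => /negP h; apply: nex; exists i.
case: n g gen i0 li0 => [|n] g gen i0 li0; first by case: i0 li0.
pose b i := l (g (lift i0 i)) / l (g i0).
exists n; split=> //; exists (fun i => g (lift i0 i) - (b i)%:P *: g i0); split.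
  by move=> i; rewrite (const_linearB lP) (const_linearZ lP) divfK ?subrr.
move=> m lm; have [c cZ] := gen m; exists (c \o lift i0).
move: (lZ _ cZ); rewrite (const_linearB lP) lm sub0r => /eqP.
rewrite oppr_eq0 (const_linear_sum lP) (bigD1_ord i0) //= (const_linearZ lP).
move=> /eqP e; move: cZ; rewrite (bigD1_ord i0) //=.
suff -> : \sum_(i < n) (c (lift i0 i))%:P *: (g (lift i0 i) - (b i)%:P *: g i0)
  = (c i0)%:P *: g i0 + \sum_(i < n) (c (lift i0 i))%:P *: g (lift i0 i) by [].
under eq_bigr do rewrite scalerBr scalerA -polyCM.
rewrite sumrB addrC; congr (_ + _).
rewrite -scaler_suml -scaleNr; congr (_ *: _).
rewrite -rmorph_sum -polyCN; congr (_%:P); apply: (mulIf li0).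
rewrite mulNr mulr_suml; apply/eqP; rewrite eq_sym -addr_eq0 -[X in _ == X]e.
apply/eqP; congr (_ + _); apply: eq_bigr => i _.
by rewrite (const_linearZ lP) /b mulrA divfK.
Qed.

(** Coefficients can be reduced modulo d, so finitely many products X^j g_i span M over k. *)
Lemma torsion_kspan M (d : {poly k}) : finitely_generated M -> d != 0 ->
  (forall m : M, d *: m = 0) -> exists n, kspan n (fun m : M => m = 0).
Proof.
move=> [n [g gen]] d0 dM; exists #|('I_n * 'I_(size d))%type : finType|.
apply: (kspan_fin (I := ('I_n * 'I_(size d))%type)
  (g := fun ij => 'X^(ij.2) *: g ij.1)) => m.
have [c ->] := gen m; exists (fun ij : 'I_n * 'I_(size d) => (c ij.1 %% d)`_ij.2).
rewrite -(pair_bigA _ (fun (i : 'I_n) (j : 'I_(size d)) =>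
  ((c i %% d)`_j)%:P *: ('X^j *: g i))) /= -sumrB big1 // => i _.
apply/eqP; rewrite subr_eq0; apply/eqP.
rewrite {1}(divp_eq (c i) d) scalerDl -scalerA dM scaler0 add0r.
under eq_bigr do rewrite scalerA mul_polyC.
rewrite -scaler_suml -poly_def; congr (_ *: _); apply/polyP => j.
rewrite coef_poly; case: ltnP => // dj; apply: nth_default.
by apply: leq_trans dj; apply: ltnW; rewrite ltn_modp.
Qed.
End PolyModules.

(** Take a minimal number of generators, and let I be the ideal of p with p g_0 in the span of the
    others. By minimality 1 is not in I, so I has a common root a, and the coefficient of g_0,
    evaluated at a, is a functional. *)
Lemma point_functional (k : closedFieldType) (M : lmodType {poly k}) :
  finitely_generated M -> (exists m : M, m != 0) ->
  exists a (l : M -> k), point_linear a l /\ exists m, l m != 0.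
Proof.
move=> fg [m0 m0nz].
pose P n := `[< exists g : 'I_n -> M, forall m, exists c : 'I_n -> {poly k},
  m = \sum_(i < n) c i *: g i >].
have exP : exists n, P n by have [n gen] := fg; exists n; apply/asboolP.
case: (ex_minnP exP) => -[|n] /asboolP[g gen] nmin.
  by case/eqP: m0nz; have [c ->] := gen m0; rewrite big_ord0.
pose I (p : {poly k}) := exists c : 'I_n -> {poly k},
  p *: g ord0 = \sum_(i < n) c i *: g (lift ord0 i).
have II a p q : I p -> I q -> I (a * p + q).
  move=> [c e] [c' e']; exists (fun i => a * c i + c' i).
  rewrite scalerDl -scalerA e e' scaler_sumr -big_split /=.
  by apply: eq_bigr => i _; rewrite scalerDl scalerA.
have [a Ia] : exists a, forall p, I p -> p.[a] = 0.
  apply: contrapT => nex; suff [c e] : I 1.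
    suff /nmin : P n by rewrite ltnn.
    apply/asboolP; exists (g \o lift ord0) => m; have [c' ->] := gen m.
    exists (fun i => c' ord0 * c i + c' (lift ord0 i)).
    rewrite big_ord_recl -{1}[c' ord0]mulr1 -scalerA e scaler_sumr -big_split /=.
    by apply: eq_bigr => i _; rewrite scalerDl scalerA.
  apply: ideal_unit => // a; apply: contrapT => na; apply: nex; exists a => p Ip.
  by apply/eqP; apply: contrapT => /negP pa; apply: na; exists p.
have /choice[c cE] := gen.
have wd (u v : 'I_n.+1 -> {poly k}) :
    \sum_i u i *: g i = \sum_i v i *: g i -> (u ord0).[a] = (v ord0).[a].
  rewrite !big_ord_recl => e; apply/eqP; rewrite -subr_eq0 -hornerN -hornerD.
  apply/eqP/Ia; exists (fun i => v (lift ord0 i) - u (lift ord0 i)).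
  under eq_bigr do rewrite scalerBl.
  rewrite sumrB scalerBl; apply/eqP; rewrite subr_eq addrAC eq_sym subr_eq.
  by rewrite e addrC.
exists a, (fun m => (c m ord0).[a]); split=> [p u v|].
  rewrite -hornerM -hornerD.
  apply: (wd _ (fun i => p * c u i + c v i)).
  rewrite -cE; under eq_bigr do rewrite scalerDl -scalerA.
  by rewrite big_split /= -scaler_sumr -!cE.
exists (g ord0).
rewrite (wd (c (g ord0)) (fun i => (i == ord0)%:R)) ?hornerC ?oner_neq0 //.
by rewrite -cE (bigD1 ord0) //= scale1r big1 ?addr0 // => i /negPf ->; rewrite scale0r.
Qed.

(** * Morphisms to skyscraper sheaves *)

Section Localization.
Variables (k W : fieldType) (ev : {rmorphism laurent k -> W}) (F : coh k).
Variable l : sec0 F -> W.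
Hypothesis lP : forall p u v, l (p *: u + v) = ev (chart0 p) * l u + l v.

(** The universal property of localization: x acts invertibly on W. It is used with W = k at a
    nonzero point, and with W = k(x). *)
Lemma extend_sec01 : exists f : sec01 F -> W,
  (forall c u v, f (c *: u + v) = ev c * f u + f v) /\
  forall m, f (res0 F m) = l m.
Proof.
have l0 : l 0 = 0.
  by apply: (addrI (l 0)); rewrite -{1}[l 0]mul1r -(rmorph1 ev)
    -(rmorph1 (@chart0 k)) -lP scaler0 !addr0.
have lZ p u : l (p *: u) = ev (chart0 p) * l u.
  by rewrite -[p *: u]addr0 lP l0 addr0.
have lD u v : l (u + v) = l u + l v.
  by rewrite -[u]scale1r lP !rmorph1 mul1r scale1r.
pose a := ev (chart0 'X).
have a0 : a != 0.
  apply: contraTneq isT => a0; have /eqP := congr1 ev (laurent_xVx k).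
  by rewrite rmorphM -/a a0 mulr0 rmorph1 eq_sym oner_eq0.
have evX n : ev (chart0 ('X^n)) = a ^+ n by rewrite !rmorphXn.
(* The chosen value fits all fractions representing s at once, so that linearity can be checked on
   any of them. *)
have /choice[f fE] (s : sec01 F) : exists v, forall n m,
    chart0 ('X ^+ n) *: s = res0 F m -> a ^+ n * v = l m.
  have [n [m e]] := (coh_loc0 F).2 s; exists (l m / a ^+ n) => n' m' e'.
  have /res0_eq0[j] : res0 F ('X^n' *: m - 'X^n *: m') = 0.
    by rewrite linearB !res0Z -e -e' !scalerA mulrC subrr.
  move=> /(congr1 l); rewrite lZ l0 evX => /eqP.
  rewrite mulf_eq0 expf_eq0 (negPf a0) andbF /= -scaleN1r lD lZ.
  rewrite -polyC1 -polyCN lZ lZ !evX polyCN !rmorphN !rmorph1 mulN1r subr_eq0 => /eqP e2.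
  by apply: (mulIf (expf_neq0 n a0)); rewrite mulrA mulfVK ?expf_neq0 // e2 mulrC.
exists f; split=> [c u v|m]; last first.
  by rewrite -[f _]mul1r -(expr0 a); apply: fE; rewrite expr0 rmorph1 scale1r.
have [n [m e]] := (coh_loc0 F).2 u; have [n' [m' e']] := (coh_loc0 F).2 v.
have [[p j] /= /eqP ep] := laurent_repr c.
have cE : c * chart0 ('X ^+ j) = chart0 p by apply: val_inj.
apply: (mulfI (expf_neq0 (j + n + n') a0)).
have key : chart0 ('X ^+ (j + n + n')) *: (c *: u + v)
    = res0 F (p *: ('X^n' *: m) + 'X^(j + n) *: m').
  rewrite [res0 F _]linearD !res0Z -e -e' scalerDr !scalerA -cE.
  by rewrite !exprD !rmorphM /=; congr (_ *: _ + _ *: _); ring.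
rewrite (fE _ _ _ key) lD !lZ !evX -(fE _ _ _ e) -(fE _ _ _ e') -cE rmorphM evX.
by rewrite !exprD; ring.
Qed.
End Localization.

Section Skyscrapers.
Variable k : fieldType.
Implicit Types F G : coh k.

(** This is Hom(F, S_x) <> 0 (see [hits_vanish]), expressed through the fibre at x on one chart
    containing x. *)
Definition hits (x : P1 k) F : Prop :=
  match x with
  | Some a => exists l : sec0 F -> k, point_linear a l /\ exists m, l m != 0
  | None => exists l : sec1 F -> k, point_linear 0 l /\ exists m, l m != 0
  end.

Lemma skyscraper_some (a : k) :
  (exists a0 : a != 0, skyscraper (Some a) = skyscraper_generic a0) \/
  (a = 0 /\ skyscraper (Some a) = skyscraper_zero k).
Proof.
have H b (r : reflect (a != 0) b) :
    let S := match r with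
      | ReflectT a0 => skyscraper_generic a0
      | ReflectF _ => skyscraper_zero k end in
    (exists a0 : a != 0, S = skyscraper_generic a0) \/
    (a = 0 /\ S = skyscraper_zero k).
  case: r => [a0|/negP]; first by left; exists a0.
  by rewrite negbK => /eqP; right.
exact: H.
Qed.

Lemma skyscraper_killed0 (a : k) (m : sec0 (skyscraper (Some a))) :
  ('X - a%:P) *: m = 0.
Proof.
move: m; case: (skyscraper_some a) => [[a0 ->]|[-> ->]] m;
  by rewrite point_scale /= /horner_eval hornerXsubC subrr mul0r.
Qed.

Lemma skyscraper_killed1 (a : k) (m : sec1 (skyscraper (Some a))) :
  (1 - a%:P * 'X) *: m = 0.
Proof.
move: m; case: (skyscraper_some a) => [[a0 ->]|[-> ->]] m; last exact: thinmx0.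
by rewrite point_scale /= /horner_eval !hornerE divff // subrr mul0r.
Qed.

Lemma skyscraper_infty0 (m : sec0 (skyscraper (None : P1 k))) : m = 0.
Proof. exact: thinmx0. Qed.

Lemma skyscraper_infty1 (m : sec1 (skyscraper (None : P1 k))) : 'X *: m = 0.
Proof. by rewrite point_scale /= /horner_eval hornerX mul0r. Qed.

Lemma skyscraper_functional0 (x : P1 k) : exists l : sec0 (skyscraper x) -> k,
  const_linear l /\ forall m, l m = 0 -> m = 0.
Proof.
case: x => [a|]; last first.
  exists (fun=> 0); split=> [c u v|m _]; [by rewrite mulr0 addr0|exact: skyscraper_infty0].
case: (skyscraper_some a) => [[a0 ->]|[_ ->]].
  exists (fun m => m : k); split=> // c u v.
  by rewrite point_scale /= /horner_eval hornerC.
exists (fun m => m : k); split=> // c u v.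
by rewrite point_scale /= /horner_eval hornerC.
Qed.

Lemma skyscraper_functional1 (x : P1 k) : exists l : sec1 (skyscraper x) -> k,
  const_linear l /\ forall m, l m = 0 -> m = 0.
Proof.
case: x => [a|]; last first.
  exists (fun m => m : k); split=> // c u v.
  by rewrite point_scale /= /horner_eval hornerC.
case: (skyscraper_some a) => [[a0 ->]|[_ ->]]; last first.
  exists (fun=> 0); split=> [c u v|m _]; [by rewrite mulr0 addr0|exact: thinmx0].
exists (fun m => m : k); split=> // c u v.
by rewrite point_scale /= /horner_eval hornerC.
Qed.

(** For a <> 0 the functional extends from U0 to U01 by localization and is then restricted to U1;
    at 0 and infinity the other components are zero. *)
Lemma hits_hom x F : hits x F ->
  exists g : coh_hom F (skyscraper x), ~ hom_is_zero g.
Proof.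
case: x => [a|] [l [lP [m0 lm0]]].
  case: (skyscraper_some a) => [[a0 ->]|[a0 ->]].
    have [f [fP fE]] : exists f : sec01 F -> k,
        (forall c u v, f (c *: u + v) = laurent_eval a0 c * f u + f v) /\
        forall m, f (res0 F m) = l m.
      apply: (@extend_sec01 k k (laurent_eval a0)) => p u v.
      by rewrite lP /= laurent_eval_chart0.
    have lin0 : linear (l : sec0 F -> sec0 (skyscraper_generic a0)).
      by move=> p u v; rewrite lP.
    have lin01 : linear (f : sec01 F -> sec01 (skyscraper_generic a0)).
      by move=> p u v; rewrite fP.
    have lin1 : linear (f \o res1 F : sec1 F -> sec1 (skyscraper_generic a0)).
      by move=> p u v; rewrite /= linearP /= fP laurent_eval_chart1.
    exists (@CohHom k F (skyscraper_generic a0) (mk_linear lin0) (mk_linear lin1)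
      (mk_linear lin01) fE (fun=> erefl)) => -[z0 _ _].
    by case/eqP: lm0; exact: (z0 m0).
  have lin0 : linear (l : sec0 F -> sec0 (skyscraper_zero k)).
    by move=> p u v; rewrite lP a0.
  exists (@CohHom k F (skyscraper_zero k) (mk_linear lin0) \0 \0
    (fun=> erefl) (fun=> erefl)) => -[z0 _ _].
  by case/eqP: lm0; exact: (z0 m0).
have lin1 : linear (l : sec1 F -> sec1 (skyscraper_infty k)).
  by move=> p u v; rewrite lP.
exists (@CohHom k F (skyscraper_infty k) \0 (mk_linear lin1) \0
  (fun=> erefl) (fun=> erefl)) => -[_ z1 _].
by case/eqP: lm0; exact: (z1 m0).
Qed.

Lemma hom_hits x F (g : coh_hom F (skyscraper x)) : ~ hom_is_zero g -> hits x F.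
Proof.
case: x g => [a|] g nz; last first.
  exists (hom1 g); split=> [p u v|]; first by rewrite linearP.
  apply: contrapT => nex; apply: nz; apply: hom_is_zero01 => m.
    exact: skyscraper_infty0.
  by apply/eqP; apply: contrapT => /negP h; apply: nex; exists m.
move: g nz; rewrite /hits; case: (skyscraper_some a) => [[a0 ->]|[a0 ->]] g nz.
  exists (hom0 g); split=> [p u v|]; first by rewrite linearP.
  apply: contrapT => nex; apply: nz.
  have g0 m : hom0 g m = 0.
    by apply/eqP; apply: contrapT => /negP h; apply: nex; exists m.
  apply: hom_is_zero01 => // m; have := hom_res1 g m.
  by rewrite (hom01_eq0 g0) => /esym.
exists (hom0 g); split=> [p u v|]; first by rewrite linearP a0.
apply: contrapT => nex; apply: nz; apply: hom_is_zero01 => m.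
  by apply/eqP; apply: contrapT => /negP h; apply: nex; exists m.
exact: thinmx0.
Qed.

Lemma point_surj (a : k) (M : lmodType {poly k}) (l : M -> k) m :
  point_linear a l -> l m != 0 -> forall c, exists m', l m' = c.
Proof.
move=> lP lm c; exists ((c / l m)%:P *: m).
by rewrite (point_linearZ lP) hornerC divfK.
Qed.

(** The nonzero section modules of S_x have dimension one over k. At a point of U01, vanishing over
    one chart forces vanishing over U01 and hence over the other, so both components are onto. *)
Lemma skyscraper_hom_surj x F (g : coh_hom F (skyscraper x)) :
  ~ hom_is_zero g -> hom_surj g.
Proof.
move=> nz; suff [s0 s1] : (forall n, exists m, hom0 g m = n) /\ (forall n, exists m, hom1 g m = n).
  by split=> //; apply: hom01_surj.
case: x g nz => [a|] g nz; last first.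
  split=> n; first by exists 0; rewrite linear0 [RHS]skyscraper_infty0.
  have [m gm] : exists m, hom1 g m != 0.
    apply: contrapT => nex; apply: nz; apply: hom_is_zero01 => m.
      exact: skyscraper_infty0.
    by apply/eqP; apply: contrapT => /negP h; apply: nex; exists m.
  apply: (@point_surj 0 _ (hom1 g) m) => // p u v; by rewrite linearP.
move: g nz; case: (skyscraper_some a) => [[a0 ->]|[a0 ->]] g nz.
  have [m gm] : exists m, hom0 g m != 0.
    apply: contrapT => nex; apply: nz.
    have g0 m : hom0 g m = 0.
      by apply/eqP; apply: contrapT => /negP h; apply: nex; exists m.
    apply: hom_is_zero01 => // m; have := hom_res1 g m.
    by rewrite (hom01_eq0 g0) => /esym.
  have [m' gm'] : exists m, hom1 g m != 0.
    apply: contrapT => nex; apply: nz.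
    have g1 m' : hom1 g m' = 0.
      by apply/eqP; apply: contrapT => /negP h; apply: nex; exists m'.
    apply: hom_is_zero01 => // m'; have := hom_res0 g m'.
    by rewrite (hom01_eq0_from1 g1) => /esym.
  split=> n.
    by apply: (@point_surj a _ (hom0 g) m) => // p u v; rewrite linearP.
  by apply: (@point_surj a^-1 _ (hom1 g) m') => // p u v; rewrite linearP.
have [m gm] : exists m, hom0 g m != 0.
  apply: contrapT => nex; apply: nz; apply: hom_is_zero01 => m.
    by apply/eqP; apply: contrapT => /negP h; apply: nex; exists m.
  exact: thinmx0.
split=> n; last by exists 0; rewrite linear0; exact/esym/thinmx0.
by apply: (@point_surj 0 _ (hom0 g) m) => // p u v; rewrite linearP.
Qed.
End Skyscrapers.

Section Hits.
Variable k : fieldType.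
Local Notation K := {fraction {poly k}}.
Local Notation x := (tofrac ('X : {poly k})).
Local Notation vL := (@laurent_val k).
Implicit Types (F G : coh k) (y z : P1 k).

Lemma not_vanish_hom F G : ~ vanish F G -> exists f : coh_hom F G, ~ hom_is_zero f.
Proof.
by move=> nv; apply: contrapT => nex; apply: nv => f; apply: contrapT => nz;
  apply: nex; exists f.
Qed.

Lemma hits_vanish y F : hits y F <-> ~ vanish F (skyscraper y).
Proof.
split=> [/hits_hom[g nz] v|/not_vanish_hom[g]]; first exact: nz.
exact: hom_hits.
Qed.

Lemma skyscraper_hits y : hits y (skyscraper y).
Proof.
case: y => [a|]; rewrite /hits.
  case: (skyscraper_some a) => [[a0 ->]|[-> ->]];
    by exists (fun m => m : k); split=> //; exists 1; exact: oner_neq0.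
by exists (fun m => m : k); split=> //; exists 1; exact: oner_neq0.
Qed.

Lemma skyscraper_nonzero y : ~ is_zero (skyscraper y).
Proof.
move=> z; have [g nz] := hits_hom (skyscraper_hits y); apply: nz.
case: z => z0 z1 z01; split=> m.
- by rewrite (z0 m) linear0.
- by rewrite (z1 m) linear0.
- by rewrite (z01 m) linear0.
Qed.

(** The equation of y kills S_y, but acts on a functional at z through a nonzero scalar; at infinity
    the sections over U0 are zero. *)
Lemma skyscraper_vanish y z : y <> z -> vanish (skyscraper y) (skyscraper z).
Proof.
move=> yz; apply: contrapT => /hits_vanish; case: y z yz => [a|] [b|] //= ab [l [lP [m]]].
- have /(congr1 l) := skyscraper_killed0 m.
  rewrite (point_linearZ lP) (const_linear0 (point_const_linear lP)) hornerXsubC.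
  move/eqP; rewrite mulf_eq0 subr_eq0 => /orP[/eqP e|/eqP ->]; last by rewrite eqxx.
  by case: ab; rewrite e.
- have /(congr1 l) := skyscraper_killed1 m.
  rewrite (point_linearZ lP) (const_linear0 (point_const_linear lP)).
  by rewrite !hornerE ?mulr0 ?subr0 ?mul1r => ->; rewrite eqxx.
- by rewrite (skyscraper_infty0 m) (const_linear0 (point_const_linear lP)) eqxx.
Qed.

Lemma skyscraper_line_vanish y n : vanish (skyscraper y) (line_bundle k n).
Proof.
apply/has_lmap_vanish => -[f fl [s /(lmap_neq0 fl)[m]]].
case: y f fl s m => [a|] f fl s m; last first.
  by rewrite (skyscraper_infty0 m) linear0 (lmap0 fl) eqxx.
have := congr1 (fun u => f (res0 _ u)) (skyscraper_killed0 m).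
rewrite /= res0Z (lmapZ fl) linear0 (lmap0 fl) => /eqP.
rewrite mulf_eq0 => /orP[|->//].
by rewrite /= tofrac_eq0 polyXsubC_eq0.
Qed.

Lemma line_hits y n : hits y (line_bundle k n).
Proof.
case: y => [a|] /=.
  exists (fun p : {poly k}^o => (p : {poly k}).[a]); split.
    by move=> p u v; rewrite !hornerE.
  by exists (1 : {poly k}); rewrite hornerC oner_eq0.
exists (fun p : {poly k}^o => (p : {poly k}).[0]); split.
  by move=> p u v; rewrite !hornerE.
by exists (1 : {poly k}); rewrite hornerC oner_eq0.
Qed.

(* The ideal of the point y is generated on U0 and U1 by these polynomials. *)
Definition point_ideal0 y : {poly k} := if y is Some a then 'X - a%:P else 1.
Definition point_ideal1 y : {poly k} := if y is Some a then 1 - a%:P * 'X else 'X.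

Lemma point_ideal0_killed y (m : sec0 (skyscraper y)) : point_ideal0 y *: m = 0.
Proof.
case: y m => [a|] m; first exact: skyscraper_killed0.
by rewrite [LHS]skyscraper_infty0.
Qed.

Lemma point_ideal1_killed y (m : sec1 (skyscraper y)) : point_ideal1 y *: m = 0.
Proof.
by case: y m => [a|] m; [exact: skyscraper_killed1|exact: skyscraper_infty1].
Qed.

(** The factor x is the transition function of O(1): the two equations form a section of O(1)
    vanishing at y. *)
Lemma point_ideal_glue y :
  vL (chart0 (point_ideal0 y)) = x * vL (chart1 (point_ideal1 y)).
Proof.
rewrite /point_ideal0 /point_ideal1; case: y => [a|]; last first.
  by rewrite vL_chart1X rmorph1 mulfV ?x_neq0.
have -> : 1 - a%:P * 'X = 1%:P + (- a)%:P * 'X :> {poly k}.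
  by rewrite polyCN mulNr.
rewrite vL_chart1D vL_chart1_comp !vL_chart1C vL_chart1X polyCN rmorphN /= rmorphB.
by rewrite mulrDr rmorph1 mulr1 mulNr mulrN mulrCA mulfV ?x_neq0 // mulr1.
Qed.

Section SkyscraperKernel.
Variables (y : P1 k) (F F' : coh k) (i : coh_hom F' F).
Variable q : coh_hom F (skyscraper y).
Hypothesis se : short_exact i q.

Lemma point_ideal0_lift m : exists m', hom0 i m' = point_ideal0 y *: m.
Proof.
by have [[_ _ e0] _ _] := se; apply/e0; rewrite linearZ /= point_ideal0_killed.
Qed.

Lemma point_ideal1_lift m : exists m', hom1 i m' = point_ideal1 y *: m.
Proof.
by have [_ [_ _ e1] _] := se; apply/e1; rewrite linearZ /= point_ideal1_killed.
Qed.

(** Multiplication by the equation of y kills S_y, so it gives a map d from F to F'. On F' it scales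
    a functional at z by a nonzero constant, so l composed with d stays nonzero. *)
Lemma kernel_hits z : z <> y -> hits z F' -> hits z F.
Proof.
have [[i0 _ _] [i1 _ _] _] := se.
case: z => [b|] zy [l [lP [m0 lm0]]].
  have /choice[d dE] := point_ideal0_lift.
  have dP p u v : d (p *: u + v) = p *: d u + d v.
    by apply: i0; rewrite linearP /= !dE scalerDr !scalerA mulrC.
  exists (l \o d); split=> [p u v|]; first by rewrite /= dP lP.
  exists (hom0 i m0); rewrite /=.
  have -> : d (hom0 i m0) = point_ideal0 y *: m0 by apply: i0; rewrite dE linearZ.
  rewrite (point_linearZ lP) mulf_neq0 // /point_ideal0.
  case: (y) zy => [a|] ab; last by rewrite hornerC oner_eq0.
  by rewrite hornerXsubC subr_eq0; apply: contra_notN ab => /eqP ->.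
have /choice[d dE] := point_ideal1_lift.
have dP p u v : d (p *: u + v) = p *: d u + d v.
  by apply: i1; rewrite linearP /= !dE scalerDr !scalerA mulrC.
exists (l \o d); split=> [p u v|]; first by rewrite /= dP lP.
exists (hom1 i m0); rewrite /=.
have -> : d (hom1 i m0) = point_ideal1 y *: m0 by apply: i1; rewrite dE linearZ.
rewrite (point_linearZ lP) mulf_neq0 // /point_ideal1.
case: (y) zy => [a|] // ab.
by rewrite !hornerE ?mulr0 ?subr0 oner_eq0.
Qed.

Lemma kernel_has_lmap n : has_lmap n F' -> has_lmap (n + 1) F.
Proof.
move=> [f' fl' [s0 fs0]]; have [_ _ [i01 _ _]] := se.
have /choice[d dE] (s : sec01 F) : exists t, hom01 i t = chart0 (point_ideal0 y) *: s.
  have [j [m ->]] := sec01_repr0 s; have [m' e] := point_ideal0_lift m.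
  exists (laurent_xV k ^+ j *: res0 F' m').
  by rewrite linearZ /= hom_res0 e res0Z !scalerA mulrC.
have dP (c : laurent k) u v : d (c *: u + v) = c *: d u + d v.
  by apply: i01; rewrite linearP /= !dE scalerDr !scalerA mulrC.
have di t : d (hom01 i t) = chart0 (point_ideal0 y) *: t.
  by apply: i01; rewrite dE linearZ.
exists (fun s => f' (d s)); last first.
  exists (hom01 i s0); rewrite di (lmapZ fl').
  apply: mulf_neq0; last exact: fs0.
  by rewrite /= tofrac_eq0 /point_ideal0; case: (y) => [a|]; rewrite ?polyXsubC_eq0 ?oner_eq0.
split=> [c u v|m|m]; first by rewrite dP (lmap_linear fl').
- have [m' e] := point_ideal0_lift m; have [p pE] := lmap_res0 fl' m'; exists p.
  by rewrite -pE; congr f'; apply: i01; rewrite dE -res0Z -e hom_res0.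
have [m' e] := point_ideal1_lift m; have [p pE] := lmap_res1 fl' m'; exists p.
(* Over U01, d multiplies by the equation from U0, which is x times the one from U1; this x turns n
   into n + 1. *)
have -> : d (res1 F m) = chart0 'X *: res1 F' m'.
  apply: i01; rewrite dE linearZ /= hom_res1 e res1Z scalerA; congr (_ *: _).
  by apply: vL_inj; rewrite point_ideal_glue.
rewrite (lmapZ fl') pE expfzDr ?x_neq0 // expr1z mulrCA; congr (_ * _).
by rewrite mulrC.
Qed.
End SkyscraperKernel.

Lemma kspan_fg (M : lmodType {poly k}) n :
  kspan n (fun m : M => m = 0) -> finitely_generated M.
Proof.
move=> [g gen]; exists n, g => m; have [c /eqP] := gen m.
by rewrite subr_eq0 => /eqP e; exists (fun i => (c i)%:P).
Qed.

(** As l is injective, [ker f] is the kernel of the functional l o f, and [kspan_drop] applies with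
    Z = 0. *)
Lemma kspan_ker (M N : lmodType {poly k}) (f : {linear M -> N}) (l : N -> k) n :
  const_linear l -> (forall m, l m = 0 -> m = 0) ->
  kspan n (fun m : M => m = 0) ->
  exists n', [/\ (n' <= n)%N, (exists m, f m <> 0) -> (n' < n)%N
    & kspan n' (fun m : ker f => m = 0)].
Proof.
move=> lP l0 sp.
have lfP : const_linear (l \o f) by move=> c u v; rewrite /= linearP lP.
have [[m fm]|z] := pselect (exists m, f m <> 0).
  have [||n' [-> [g [g0 gen]]]] := kspan_drop sp lfP.
  - by move=> ? ->; exact: const_linear0 lfP.
  - by exists m; apply/eqP => /l0.
  exists n'; split=> //.
  have /choice[h hE] i : exists m' : ker f, ker_val m' = g i.
    exact/ker_ex/l0/g0.
  exists h => m'; have [|c cE] := gen (ker_val m').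
    by rewrite /= ker_valP (const_linear0 lP).
  exists c; apply: val_inj; rewrite raddfB raddf_sum /= -[RHS]cE.
  by congr (_ - _); apply: eq_bigr => i _; rewrite -hE.
exists n; split=> //; have [g gen] := sp.
have f0 m : f m = 0 by apply: contrapT => fm; apply: z; exists m.
have /choice[h hE] i : exists m' : ker f, ker_val m' = g i.
  by apply: ker_ex; rewrite f0.
exists h => m'; have [c cE] := gen (ker_val m').
exists c; apply: val_inj; rewrite raddfB raddf_sum /= -[RHS]cE.
by congr (_ - _); apply: eq_bigr => i _; rewrite -hE.
Qed.

(** The measure adds up both charts because a point at 0 or infinity is visible on one of them
    only. *)
Lemma skyscraper_kernel y F n0 n1 :
  kspan n0 (fun m : sec0 F => m = 0) -> kspan n1 (fun m : sec1 F => m = 0) ->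
  hits y F ->
  exists F' (i : coh_hom F' F) (q : coh_hom F (skyscraper y)) n0' n1',
    [/\ short_exact i q, (n0' + n1' < n0 + n1)%N,
        kspan n0' (fun m : sec0 F' => m = 0)
      & kspan n1' (fun m : sec1 F' => m = 0)].
Proof.
move=> sp0 sp1 /hits_hom[q nz].
have [l0 [lP0 li0]] := skyscraper_functional0 y.
have [l1 [lP1 li1]] := skyscraper_functional1 y.
have [n0' [le0 lt0 sp0']] := kspan_ker (hom0 q) lP0 li0 sp0.
have [n1' [le1 lt1 sp1']] := kspan_ker (hom1 q) lP1 li1 sp1.
have qs := skyscraper_hom_surj nz.
have fg0 := kspan_fg sp0'; have fg1 := kspan_fg sp1'.
exists (sub_coh fg0 fg1), (sub_incl fg0 fg1), q, n0', n1'; split=> //.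
  by case: qs => s0 s1 s01; split; apply: ker_short_exact.
have [e|ne] := pselect (exists m, hom0 q m <> 0).
  by move: (lt0 e); lia.
suff /lt1 : exists m, hom1 q m <> 0 by lia.
apply: contrapT => nex; apply: nz; apply: hom_is_zero01 => m; apply: contrapT => h.
  by apply: ne; exists m.
by apply: nex; exists m.
Qed.

Definition X_multiple (M : lmodType {poly k}) (m : M) : Prop :=
  exists m', m = 'X *: m'.

(* The rank drops by one: the fibre at 0 of F is that of F' plus a line. *)
Lemma line_kernel n F r (q : coh_hom F (line_bundle k n)) e0 e1 :
  hom0 q e0 = 1 -> hom1 q e1 = 1 ->
  kspan r (@X_multiple (sec0 F)) ->
  exists F' (i : coh_hom F' F) r',
    [/\ short_exact i q, r = r'.+1 & kspan r' (@X_multiple (sec0 F'))].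
Proof.
move=> qe0 qe1 sp.
(* The element e splits f, so the projections g_i - f(g_i) e of generators of M generate the
   kernel. *)
have fgk (M : lmodType {poly k}) (f : {linear M -> {poly k}^o}) e :
    f e = 1 -> finitely_generated M -> finitely_generated (ker f).
  move=> fe [s [g gen]].
  have /choice[h hE] i : exists m' : ker f, ker_val m' = g i - f (g i) *: e.
    by apply: ker_ex; rewrite linearB linearZ /= fe [X in _ - X]mulr1 subrr.
  exists s, h => m; have [c cE] := gen (ker_val m); exists c; apply: val_inj.
  rewrite raddf_sum /= [LHS]cE.
  under [RHS]eq_bigr => i _ do rewrite hE scalerBr scalerA.
  rewrite sumrB -scaler_suml.
  suff -> : \sum_(i < s) c i * f (g i) = 0 by rewrite scale0r subr0.
  rewrite -[RHS](ker_valP m) cE linear_sum.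
  by apply: eq_bigr => i _; rewrite linearZ.
have fg0 := fgk _ _ _ qe0 (coh_fg0 F); have fg1 := fgk _ _ _ qe1 (coh_fg1 F).
have s0 : forall p, exists m, hom0 q m = p.
  by move=> p; exists ((p : {poly k}) *: e0); rewrite linearZ /= qe0 [LHS]mulr1.
have s1 : forall p, exists m, hom1 q m = p.
  by move=> p; exists ((p : {poly k}) *: e1); rewrite linearZ /= qe1 [LHS]mulr1.
have s01 := hom01_surj s0.
exists (@sub_coh _ _ _ q fg0 fg1), (@sub_incl _ _ _ q fg0 fg1).
pose l m := (hom0 q m : {poly k}).[0].
have lP : const_linear l by move=> c u v; rewrite /l linearP /= !hornerE.
have [||r' [-> [g [g0 gen]]]] := kspan_drop sp lP.
- by move=> _ [m ->]; rewrite /l linearZ /= !hornerE.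
- by exists e0; rewrite /l qe0 hornerC oner_neq0.
exists r'; split=> //; first by split; apply: ker_short_exact.
have /choice[h hE] i : exists m' : ker (hom0 q), ker_val m' = g i - hom0 q (g i) *: e0.
  by apply: ker_ex; rewrite linearB linearZ /= qe0 [X in _ - X]mulr1 subrr.
(* [kspan_drop] only makes q(g_i) vanish at 0, so that it is t_i X. Then h_i = g_i - t_i X e0 is in
   the kernel and agrees with g_i modulo X. *)
have /choice[t tE] i : exists t : {poly k}, hom0 q (g i) = t * 'X.
  have /eqP/factor_theorem[t tE] := g0 i.
  by exists t; rewrite tE subr0.
exists h => m; have [|c [m1 cE]] := gen (ker_val m).
  by rewrite /l ker_valP horner0.
exists c; pose m2 := m1 + \sum_i ((c i)%:P * t i) *: e0.
have e : ker_val m - \sum_i (c i)%:P *: ker_val (h i) = 'X *: m2.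
  rewrite /m2 scalerDr -cE -addrA; congr (_ + _).
  under eq_bigr => i _ do rewrite hE scalerBr scalerA tE.
  rewrite sumrB opprB addrC; congr (_ + _).
  rewrite scaler_sumr; apply: eq_bigr => i _; rewrite scalerA; congr (_ *: _).
  by rewrite [RHS]mulrC mulrA.
(* X m2 is in the kernel and k[x] is a domain, so m2 is too: the congruence holds modulo X times the
   kernel, not just modulo X F. *)
have [m2' m2E] : exists m2' : ker (hom0 q), ker_val m2' = m2.
  apply: ker_ex; have : hom0 q ('X *: m2) = 0.
    rewrite -e linearB linear_sum /= ker_valP big1 ?subr0 // => i _.
    by rewrite linearZ /= ker_valP scaler0.
  by rewrite linearZ /= => /eqP; rewrite mulf_eq0 polyX_eq0 => /eqP.
exists m2'; pose v := mk_linear (ker_val_linear (f := hom0 q)).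
suff ve : v (m - \sum_i (c i)%:P *: h i) = v ('X *: m2') by apply: val_inj.
rewrite linearB linear_sum [RHS]linearZ /= m2E -e; congr (_ - _).
Qed.
End Hits.

(** * Filtrations by line bundles and skyscraper sheaves *)

Section TorsionSheaves.
Variable k : fieldType.
Local Notation K := {fraction {poly k}}.
Local Notation x := (tofrac ('X : {poly k})).
Local Notation vL := (@laurent_val k).
Implicit Types (F G : coh k) (y z : P1 k).

Fact laurent_val_zmod : zmod_morphism vL. Proof. by []. Qed.
Fact laurent_val_monoid : monoid_morphism vL. Proof. by []. Qed.
Definition laurent_valM : {rmorphism laurent k -> K} :=
  HB.pack vL (GRing.isZmodMorphism.Build (laurent k) K vL laurent_val_zmod)
    (GRing.isMonoidMorphism.Build (laurent k) K vL laurent_val_monoid).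

(** The functional extends to U01 with values in k(x). On the finitely many generators of F(U1) the
    values lie in x^e k[1/x] for various e, and n = N is the largest of these. *)
Lemma functional_has_lmap F (f0 : {linear sec0 F -> {poly k}^o}) m :
  f0 m != 0 -> exists n, has_lmap n F.
Proof.
move=> fm.
have [f [fP fE]] : exists f : sec01 F -> K,
    (forall c u v, f (c *: u + v) = vL c * f u + f v) /\
    forall m, f (res0 F m) = tofrac (f0 m : {poly k}).
  apply: (@extend_sec01 k K laurent_valM F (fun m => tofrac (f0 m : {poly k}))) => p u v.
  by rewrite linearP /= rmorphD rmorphM.
have f_0 : f 0 = 0 by rewrite -[0](linear0 (res0 F)) fE linear0 rmorph0.
have fD u v : f (u + v) = f u + f v by rewrite -[u]scale1r fP mul1r scale1r.
have fZ c u : f (c *: u) = vL c * f u by rewrite -[c *: u]addr0 fP f_0 addr0.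
have [r [h gen]] := coh_fg1 F.
have /choice[b bP] i : exists b : nat * {poly k},
    f (res1 F (h i)) = vL (chart1 b.2) * x ^+ b.1.
  have [j [m' ->]] := sec01_repr0 (res1 F (h i)).
  have [n [q e]] := laurent_chart1 (laurent_xV k ^+ j * chart0 (f0 m')).
  exists (n, q); rewrite [(_, _).1]/= [(_, _).2]/= fZ fE -e !vLM.
  have -> : vL (laurent_xV k ^+ n) = x ^- n.
    by rewrite -vL_chart1Xn rmorphXn /= chart1X.
  by rewrite mulrAC mulVf ?mul1r // expf_neq0 // x_neq0.
pose N := \max_(i < r) (b i).1.
exists N%:Z; exists f; last first.
  by exists (res0 F m); rewrite fE tofrac_eq0.
split=> // [m'|m']; first by exists (f0 m').
have [c ->] := gen m'.
exists (\sum_(i < r) c i * ((b i).2 * 'X^(N - (b i).1))).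
rewrite linear_sum (big_morph f fD f_0) rmorph_sum.
rewrite (big_morph vL (fun _ _ => erefl) erefl) mulr_suml.
apply: eq_bigr => i _; rewrite res1Z fZ bP.
have iN : ((b i).1 <= N)%N by exact: (leq_bigmax i).
rewrite 2!vL_chart1_comp vL_chart1Xn -!mulrA; congr (_ * (_ * _)).
have -> : x ^ N%:Z = x ^+ (N - (b i).1) * x ^+ (b i).1 by rewrite -exprD subnK.
by rewrite mulrA mulVf ?mul1r // expf_neq0 // x_neq0.
Qed.

Lemma torsion0 F : (forall n, ~ has_lmap n F) ->
  exists2 d : {poly k}, d != 0 & forall m : sec0 F, d *: m = 0.
Proof.
move=> nl; have [r [g gen]] := coh_fg0 F.
have [//|[f [m fm]]] := torsion_or_functional gen.
by have [n /nl] := functional_has_lmap fm.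
Qed.

Lemma torsion_kspans F : (forall n, ~ has_lmap n F) ->
  exists n0 n1, kspan n0 (fun m : sec0 F => m = 0) /\
    kspan n1 (fun m : sec1 F => m = 0).
Proof.
move=> nl; have [d d0 dF] := torsion0 nl.
have [n0 sp0] := torsion_kspan (coh_fg0 F) d0 dF.
have [r [g gen]] := coh_fg1 F.
have [[d1 d10 dF1]|[f [m fm]]] := torsion_or_functional gen.
  have [n1 sp1] := torsion_kspan (coh_fg1 F) d10 dF1.
  by exists n0, n1.
(* The annihilator d passes to U1: up to a power of x it is q(1/x), so q m vanishes on U01 and X^j q
   kills m, against f m <> 0. *)
have [n [q qE]] := laurent_chart1 (chart0 d).
have q0 : q != 0.
  apply: contraNneq d0 => q0; apply/eqP/chart0_inj.
  rewrite rmorph0 -[chart0 d]mul1r.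
  have <- : chart0 'X ^+ n * laurent_xV k ^+ n = 1 by rewrite mulrC xVXn.
  by rewrite -mulrA qE q0 rmorph0 mulr0.
have : res1 F (q *: m) = 0.
  rewrite res1Z -qE; have [j [m' ->]] := sec01_repr0 (res1 F m).
  by rewrite scalerA mulrAC -scalerA -res0Z dF linear0 scaler0.
move=> /(coh_loc1 F).1[j] /(congr1 f); rewrite !linearZ linear0 /= => /eqP.
rewrite [_ *: _]/(_ * (_ * _)) !mulf_eq0 (negPf q0) (negPf fm) expf_eq0.
by rewrite polyX_eq0 andbF.
Qed.
End TorsionSheaves.

Lemma list_min (T : eqType) (le : rel T) (s : seq T) (P : T -> Prop) :
  linear_order le -> (exists t, P t) -> (forall t, P t -> t \in s) ->
  exists2 t, P t & forall u, P u -> le t u.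
Proof.
move=> [refl anti trans tot]; elim: s P => [|t s IH] P [u Pu] Ps.
  by have := Ps _ Pu.
have [[v [Pv vt]]|nex] := pselect (exists v, P v /\ v <> t); last first.
  exists u => // w Pw; suff [-> ->] : w = t /\ u = t by [].
  by split; apply: contrapT => h; apply: nex; [exists w|exists u].
have [||w [Pw wt] wmin] := IH (fun v => P v /\ v <> t).
- by exists v.
- by move=> z [Pz zt]; have := Ps _ Pz; rewrite inE => /predU1P[].
have [[Pt tw]|nt] := pselect (P t /\ le t w).
  exists t => // z Pz; have [->//|zt] := pselect (z = t).
  by apply: trans tw _; apply: wmin.
exists w => // z Pz; have [zt|zt] := pselect (z = t); last exact: wmin.
by rewrite zt in Pz *; have /orP[//|tw] := tot w t; case: nt.
Qed.

Section Existence.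
Variables (k : closedFieldType) (le : rel (P1 k)).
Hypothesis le_order : linear_order le.
Implicit Types (F G : coh k) (y z : P1 k).

Definition standard_object (b : int + P1 k) : coh k :=
  match b with inl n => line_bundle k n | inr y => skyscraper y end.

Lemma standard_le_order : linear_order (standard_le le).
Proof.
have [refl anti trans tot] := le_order; split.
- by case=> [n|y] /=.
- case=> [m|y] [n|z] //= h; first by congr inl; apply/eqP; rewrite eq_le.
  by congr inr; apply: anti.
- case=> [m|y] [n|z] [p|w] //=; first exact: le_trans.
  exact: trans.
- case=> [m|y] [n|z] //=; exact: le_total.
Qed.

Lemma standard_vanish b c : ~~ standard_le le b c ->
  vanish (standard_object b) (standard_object c).
Proof.
case: b c => [m|y] [n|z] //=.
- by rewrite -ltNge; exact: line_vanish.
- by move=> _; exact: skyscraper_line_vanish.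
move=> yz; apply: skyscraper_vanish => e.
by have [refl _ _ _] := le_order; rewrite e refl in yz.
Qed.

Lemma standard_nonzero b : ~ is_zero (standard_object b).
Proof. by case: b => [n|y]; [exact: line_nonzero|exact: skyscraper_nonzero]. Qed.

(** If F(U0) = 0, then F(U01) = 0, every section over U1 is killed by a power of y, and the only
    possible point is y = 0. *)
Lemma nonzero_hits F : ~ is_zero F -> exists y, hits y F.
Proof.
move=> nz; have [[m m0]|z0] := pselect (exists m : sec0 F, m != 0).
  have [|a [l lP]] := point_functional (coh_fg0 F); first by exists m.
  by exists (Some a), l.
have F0 (m : sec0 F) : m = 0.
  by apply/eqP; apply: contrapT => /negP h; apply: z0; exists m.
have [[m m0]|z1] := pselect (exists m : sec1 F, m != 0); last first.
  case: nz; apply: is_zero01 => // m.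
  by apply/eqP; apply: contrapT => /negP h; apply: z1; exists m.
have [|b [l [lP [m1 lm1]]]] := point_functional (coh_fg1 F); first by exists m.
have [b0|b0] := eqVneq b 0.
  by rewrite b0 in lP; exists None, l; split=> //; exists m1.
have /(coh_loc1 F).1[j /(congr1 l)] : res1 F m1 = 0 by exact: sec01_zero.
rewrite (point_linearZ lP) (const_linear0 (point_const_linear lP)) hornerXn.
by move/eqP; rewrite mulf_eq0 expf_eq0 (negPf b0) andbF (negPf lm1).
Qed.

(** A functional l at a sends d m = 0 to d(a) l(m), so the points of U0 that are hit are roots of
    the annihilator d; infinity is added to the list. *)
Lemma torsion_min_point F : (forall n, ~ has_lmap n F) -> ~ is_zero F ->
  exists2 y, hits y F & forall z, hits z F -> le y z.
Proof.
move=> nl nz; have [d d0 dF] := torsion0 nl.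
have [s sE] := closed_field_poly_normal d.
apply: (@list_min (option k) le (None :: map Some s)) => //.
  exact: nonzero_hits.
case=> [a|] //= [l [lP [m lm]]]; rewrite inE /= mem_map; last by move=> ? ? [].
have /(congr1 l) := dF m.
rewrite (point_linearZ lP) (const_linear0 (point_const_linear lP)) => /eqP.
rewrite mulf_eq0 (negPf lm) orbF sE hornerZ mulf_eq0 lead_coef_eq0 (negPf d0) /=.
by rewrite -rootE root_prod_XsubC.
Qed.

Local Notation std := (filtered standard_object).

Lemma filtered_head b s F : std (b :: s) F -> ~ vanish F (standard_object b).
Proof.
move=> Fs; inversion Fs as [|? ? F' ? i q se _]; subst => v.
exact: (standard_nonzero (surj_zero_hom (short_exact_surj se) (v q))).
Qed.

Lemma torsion_filtered F : (forall n, ~ has_lmap n F) ->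
  exists2 s, sorted (standard_le le) s & std s F.
Proof.
move=> nl; have [n0 [n1 [sp0 sp1]]] := torsion_kspans nl.
have [N] := ubnP (n0 + n1); elim: N n0 n1 F nl sp0 sp1 => // N IH n0 n1 F nl sp0 sp1 le_N.
have [F0|F0] := pselect (is_zero F); first by exists [::] => //; exact: filtered_nil.
have [y yF ymin] := torsion_min_point nl F0.
have [F' [i [q [n0' [n1' [se lt' sp0' sp1']]]]]] := skyscraper_kernel sp0 sp1 yF.
have nl' n : ~ has_lmap n F'.
  by move=> /(kernel_has_lmap se); exact: nl.
have [|s srt Fs] := IH n0' n1' F' nl' sp0' sp1'.
  by apply: leq_trans lt' _.
exists (inr y :: s); last exact: (filtered_cons (b := inr y)) se Fs.
case: s srt Fs => //= b s srt /filtered_head nv; rewrite srt andbT.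
case: b nv {srt} => [n|z] /= nv; first by case: nv; apply/has_lmap_vanish.
have [->|zy] := pselect (z = y); first by have [refl _ _ _] := le_order.
have /hits_vanish hz := nv.
by apply: ymin; exact: kernel_hits se z zy hz.
Qed.

Lemma standard_filtered F : exists2 s, sorted (standard_le le) s & std s F.
Proof.
have [r sp] : exists r, kspan r (@X_multiple _ (sec0 F)).
  have [r [g gen]] := coh_fg0 F; exists r, g => m; have [c ->] := gen m.
  exists (fun i => (c i).[0]).
  have /choice[t tE] i : exists t : {poly k}, c i - (c i).[0]%:P = t * 'X.
    have /factor_theorem[t tE] : root (c i - (c i).[0]%:P) 0.
      by rewrite rootE !hornerE subrr.
    by exists t; rewrite tE subr0.
  exists (\sum_i t i *: g i); rewrite -sumrB scaler_sumr; apply: eq_bigr => i _.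
  by rewrite -scalerBl tE scalerA mulrC.
(* For r = 0 a map to a line bundle is impossible, as [line_kernel] would give 0 = r' + 1; the two
   cases are run in parallel. *)
elim: r F sp => [|r IH] F sp.
all: have [[n0 h]|nl] := pselect (exists n, has_lmap n F); last first.
1,3: by apply: torsion_filtered => n h; apply: nl; exists n.
all: have [n [hn nmin]] := lmap_min h.
all: have [q [[e0 qe0] [e1 qe1]]] := min_line_quotient hn nmin.
all: have [F' [i [r' [se rE sp']]]] := line_kernel qe0 qe1 sp => //.
case: rE => rE; rewrite -rE in sp'; have [s srt Fs] := IH _ sp'.
exists (inl n :: s); last exact: (filtered_cons (b := inl n)) se Fs.
case: s srt Fs => //= b s srt /filtered_head nv; rewrite srt andbT.
case: b nv {srt} => [m|z] //= /has_lmap_vanish nv.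
rewrite leNgt; apply/negP => mn; apply: nmin.
by apply: (line_kernel_has_lmap se mn); apply: contrapT.
Qed.
End Existence.

(** * Refinement of stability data *)

(** This is the well-ordering principle; transitivity follows by looking at the least element of {x,
    y, z}. *)
Lemma linear_order_exists (T : eqType) : exists le : rel T, linear_order le.
Proof.
have [le wo] := wochoice.well_ordering_principle T.
have wc : wochoice.wo_chain le predT by move=> A _; exact: wo.
have tot : total le by move=> x y; apply: (wochoice.wo_chainW wc).
have refl : reflexive le by move=> x; apply: (wochoice.wo_chain_reflexive wc).
have anti : antisymmetric le.
  by move=> x y; apply: (wochoice.wo_chain_antisymmetric wc).
exists le; split=> // y x z xy yz.
have [|w [[wA lw] _]] := wo (mem [:: x; y; z]); first by exists x; exact: mem_head.
have lwx : le w x by apply: lw; rewrite !inE eqxx.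
have lwy : le w y by apply: lw; rewrite !inE eqxx orbT.
have lwz : le w z by apply: lw; rewrite !inE eqxx !orbT.
move: wA; rewrite !inE => /or3P[] /eqP e; rewrite e in lwx lwy lwz => //.
- by have -> : x = y by apply: anti; rewrite xy.
have e2 : z = y by apply: anti; rewrite lwy.
by rewrite e2.
Qed.

Section LineStability.
Variable k : closedFieldType.
Implicit Types (F G : coh k) (y z : P1 k).

(** For any order on the points, the top factor of the standard filtration is not a line bundle, so
    by sortedness all factors are skyscrapers. The bottom one embeds in F and receives a map from
    O(n). *)
Lemma torsion_line_hom F n : ~ is_zero F -> (forall m, ~ has_lmap m F) ->
  exists f : coh_hom (line_bundle k n) F, ~ hom_is_zero f.
Proof.
move=> F0 nl; have [le le_order] := linear_order_exists (option k).
have [s srt Fs] := @standard_filtered k le le_order F.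
case: s srt Fs => [_ Fs|b s srt Fs]; first by inversion Fs.
have [i ii] := filtered_last Fs.
have [y yE] : exists y, last b s = inr y.
  case: b srt {i ii} Fs => [m|y] srt Fs.
    by case: (filtered_head Fs); exact/has_lmap_vanish.
  elim: s y srt {Fs} => [|c s IH] y /=; first by exists y.
  by case: c => [//|z] /andP[_ /IH].
rewrite yE in i ii *.
have [g gnz] := hits_hom (line_hits y n).
by exists (comp_hom i g) => /(comp_zero_inj ii).
Qed.

Lemma line_hom_inj m n (f : coh_hom (line_bundle k m) (line_bundle k n)) :
  ~ hom_is_zero f -> forall s, hom01 f s = 0 -> s = 0.
Proof.
move=> nz s fs; have fE (u : (laurent k)^o) : hom01 f u = (u : laurent k) * (hom01 f 1 : laurent k).
  by rewrite -[in LHS](mulr1 u) -[u * 1]/((u : laurent k) *: (1 : (laurent k)^o)) linearZ.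
have f1 : hom01 f 1 != 0.
  apply/eqP => f1; apply: nz; apply: line_hom_zero => u.
  by rewrite fE f1 mulr0.
apply: vL_inj; apply/eqP; have /eqP := congr1 (@laurent_val k) (fE s).
rewrite fs vLM eq_sym mulf_eq0 => /orP[//|/eqP e].
by case/eqP: f1; apply: vL_inj.
Qed.

Variable D : slicing k.
Hypothesis Dst : is_stability_data D.

Lemma line_semistable n : exists a : phase D, slice a (line_bundle k n).
Proof.
have [a [b [A [B [j [p [[Aa Bb] [ji ps] A0 B0 cs]]]]]]] := HN_ends Dst (@line_nonzero k n).
case: cs => [[_ ?]|[ba pj]]; first by exists a.
have jnz : ~ hom_is_zero j by move=> /(inj_zero_hom ji).
(* B is torsion: a nonzero B -> O(m) would make the composite O(n) -> O(m) injective, although it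
   kills the image of A. *)
have [[m hm]|nl] := pselect (exists m, has_lmap m B).
  have [f fnz] : exists f : coh_hom B (line_bundle k m), ~ hom_is_zero f.
    by apply: not_vanish_hom => /has_lmap_vanish.
  have fp : ~ hom_is_zero (comp_hom f p) by move=> /(comp_zero_surj ps).
  case: jnz; have [p0 p1 p01] := pj.
  have j01 s : hom01 j s = 0.
    by apply: (line_hom_inj fp); rewrite /= [hom01 p _]p01 linear0.
  by apply: line_hom_zero => s; rewrite j01.
have Bl m : ~ has_lmap m B by move=> h; apply: nl; exists m.
have hA : has_lmap n A by apply: contrapT => /has_lmap_vanish /(_ j).
have [c [hc cmin]] := lmap_min hA.
have [q [[e0 qe0] [e1 qe1]]] := min_line_quotient hc cmin.
have qs : hom_surj q.
  have s0 r : exists m, hom0 q m = r.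
    by exists ((r : {poly k}) *: e0); rewrite linearZ /= qe0 [LHS]mulr1.
  split=> [//|r|]; last exact: hom01_surj.
  by exists ((r : {poly k}) *: e1); rewrite linearZ /= qe1 [LHS]mulr1.
have [f fnz] := torsion_line_hom c B0 Bl.
have fq : ~ hom_is_zero (comp_hom f q) by move=> /(comp_zero_surj qs).
by move: ba; rewrite /phase_lt (hom_phase_le Dst Aa Bb fq).
Qed.
End LineStability.

Theorem proposition6p4 (k : closedFieldType) (D : slicing k) :
  finest D ->
  exists le : rel (P1 k),
    linear_order le /\ equivalent (standard_slicing le) D.
Proof.
move=> [Dst Dfinest].
have /choice[r rE] b : exists a : phase D, slice a (standard_object b).
  case: b => [n|y]; first exact: line_semistable.
  by apply: (simple_semistable Dst); [exact: skyscraper_nonzero|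
    move=> A i; exact: skyscraper_hom_surj].
have [wo [wrefl wanti wtrans wtot]] := linear_order_exists (option k).
have [reflD antiD transD totD] := stab_order Dst.
(* Lexicographic: by phase in D, then by [wo] among points of equal phase, which restores
   antisymmetry. *)
pose le : rel (P1 k) := fun y z => phase_le (r (inr y)) (r (inr z)) &&
  (phase_le (r (inr z)) (r (inr y)) ==> wo y z).
have le_order : linear_order le.
  split.
  - by move=> y; rewrite /le reflD wrefl.
  - move=> y z /andP[/andP[yz h] /andP[zy h']]; apply: wanti.
    by move: h h'; rewrite zy yz /= => -> ->.
  - move=> z y w /andP[yz h] /andP[zw h']; rewrite /le (transD _ _ _ yz zw) /=.
    apply/implyP => wy.
    have zy := transD _ _ _ zw wy; have wz := transD _ _ _ wy yz.
    by move: h h'; rewrite zy wz; exact: wtrans.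
  - move=> y z; rewrite /le; have := totD (r (inr y)) (r (inr z)).
    by case: (phase_le _ _) (phase_le _ _) => [] [] //= _; exact: wtot.
exists le; split=> //; have sE : standard_slicing le =
    family_slicing (standard_le le) (@standard_object k).
  by congr Slicing; apply/funext => -[].
rewrite sE; apply: Dfinest.
  apply: (family_stability (standard_le_order le_order)).
  - exact: standard_nonzero.
  - by move=> b c; apply: standard_vanish.
  - exact: standard_filtered.
apply: (family_finer (standard_le_order le_order) _ _ Dst (r := r)) => //.
- exact: standard_nonzero.
- exact: standard_filtered.
(* Nonzero morphisms O(m) -> O(n) for m <= n and O(m) -> S_z make r monotone; between points this is
   built into [le]. *)
have nv b c : ~ vanish (standard_object b) (standard_object c) -> phase_le (r b) (r c).
  by move=> /not_vanish_hom[f nz]; exact: (hom_phase_le Dst (rE b) (rE c) nz).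
case=> [m|y] [n|z] //= h.
- by apply: nv => /has_lmap_vanish; apply; exact: line_has_lmap.
- by apply: nv; apply/hits_vanish; exact: line_hits.
- by case/andP: h.
Qed.
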